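(* Let $\kappa\in(0,\infty)$, let $c\geq 3$ and let $$\mathcal{H}:(\mathscr{C}(\mathbb{E}^{c}),\wedge,\vee)\to(Cvx_{[0,\kappa]}(\mathbb{E}^{c}),\sqcap_{+},\sqcup_{+})$$ be a non-trivial lattice homomorphism, i.e. $\mathcal{H}(C\wedge D)=\mathcal{H}(C)\sqcap_{+}\mathcal{H}(D)$ and $\mathcal{H}(C\vee D)=\mathcal{H}(C)\sqcup_{+}\mathcal{H}(D)$ for all $C,D\in\mathscr{C}(\mathbb{E}^{c})$, and $\mathcal{H}$ is not constant. Then there is an affine bijection $\phi:\mathbb{E}^{c}\to\mathbb{E}^{c}$ such that $\mathcal{H}(C)=1^{\infty}_{\phi(C)}$ for all $C\in\mathscr{C}(\mathbb{E}^{c})$.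
   Context: $\mathbb{E}^{c}$ is $c$-dimensional Euclidean space; $\mathscr{C}(\mathbb{E}^{c})$ is the lattice of all compact convex subsets of $\mathbb{E}^{c}$, including $\emptyset$, with $C\wedge D=C\cap D$, $C\vee D=\operatorname{conv}(C\cup D)$. $Cvx(\mathbb{E}^{c})$ is the set of all lower semi-continuous convex functions $f:\mathbb{E}^{c}\to(-\infty,\infty]$ together with the constant function $-\infty$. Let $$Cvx_{[0,\infty]}(\mathbb{E}^{c})=\{f\in Cvx(\mathbb{E}^{c})\mid f\geq 0\text{ and }f(x)=0\text{ for some }x\in\mathbb{E}^{c}\}\cup\{+\infty\},$$ where $+\infty$ is the constant function. For $f,g\in Cvx_{[0,\infty]}(\mathbb{E}^{c})$ let $f\sqcap_{+}g=\min\{h\in Cvx_{[0,\infty]}(\mathbb{E}^{c})\mid f,g\leq h\}$ and $f\sqcup_{+}g=\max\{h\in Cvx_{[0,\infty]}(\mathbb{E}^{c})\mid f,g\geq h\}$, where $\min$, $\max$ are the least and greatest elements with respect to the pointwise order (they exist). For $\kappa\in(0,\infty)$, $$Cvx_{[0,\kappa]}(\mathbb{E}^{c})=\{f:\mathbb{E}^{c}\to[0,\kappa]\cup\{+\infty\}\mid f\in Cvx_{[0,\infty]}(\mathbb{E}^{c})\text{ and }f^{-1}([0,\kappa])\text{ is compact}\}.$$ For $C\subseteq\mathbb{E}^{c}$, $1^{\infty}_{C}:\mathbb{E}^{c}\to\{0,\infty\}$ is the function equal to $0$ on $C$ and $\infty$ off $C$. *)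

(* Defs.v *)
From HB Require Import structures.
From mathcomp Require Import all_boot all_order all_algebra.
From mathcomp Require Import all_classical all_reals all_analysis.

Set Implicit Arguments.
Unset Strict Implicit.
Unset Printing Implicit Defensive.

Import Order.TTheory GRing.Theory Num.Theory.
Import numFieldNormedType.Exports.

Local Open Scope classical_set_scope.
Local Open Scope ring_scope.

(* E^c is modelled by 'rV[R]_c; its topology (that of the sup norm) is the
   Euclidean one, and the Euclidean metric is not used otherwise. *)

Section ConvexSets.
Context (R : realType) (c : nat).
Local Notation E := 'rV[R]_c.

Definition conv_hull (A : set E) : set E := smallest (@convex_set R E) A.

Definition compact_convex : set (set E) :=
  [set C | compact C /\ @convex_set R E C].

Definition affine_map (phi : E -> E) : Prop :=
  exists (L : {linear E -> E}) (b : E), forall x, phi x = L x + b.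

End ConvexSets.

Section ConvexFunctions.
Context (R : realType) (c : nat).
Local Notation E := 'rV[R]_c.
Local Open Scope ereal_scope.

(* At t = 0 and t = 1 this relies on the convention 0 * +oo = 0, which holds
   in \bar R. *)
Definition convex_efun (f : E -> \bar R) : Prop :=
  forall (x y : E) (t : R), (0 <= t <= 1)%R ->
    f (t *: x + (1 - t) *: y)%R <= t%:E * f x + (1 - t)%:E * f y.

Definition Cvx : set (E -> \bar R) :=
  [set f | (forall x, -oo < f x) /\ lower_semicontinuous f /\ convex_efun f]
  `|` [set cst -oo].

Definition Cvx_0y : set (E -> \bar R) :=
  [set f | Cvx f /\ (forall x, 0 <= f x) /\ exists x, f x = 0]
  `|` [set cst +oo].

Definition Cvx_0k (k : R) : set (E -> \bar R) :=
  [set f | (forall x, 0 <= f x <= k%:E \/ f x = +oo) /\ Cvx_0y f /\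
           compact (f @^-1` [set y | 0 <= y <= k%:E])].

Definition indic_oo (C : set E) : E -> \bar R :=
  fun x => if x \in C then 0 else +oo.

(* [<=%O] on functions is the pointwise order; [A `&` lbound A] is the set
   (with at most one element) of least elements of [A], and dually.  The default
   value of [xget] is irrelevant by [cvx_meetP] and [cvx_joinP]. *)
Definition cvx_meet (f g : E -> \bar R) : E -> \bar R :=
  let A := Cvx_0y `&` ubound [set f; g] in xget (cst +oo) (A `&` lbound A).

Definition cvx_join (f g : E -> \bar R) : E -> \bar R :=
  let A := Cvx_0y `&` lbound [set f; g] in xget (cst +oo) (A `&` ubound A).

End ConvexFunctions.

Section Existence.
Context (R : realType) (c : nat).
Local Notation E := 'rV[R]_c.
Local Open Scope ereal_scope.
Implicit Types (f g h : E -> \bar R) (S : set (E -> \bar R)).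

Lemma Cvx_0y_ge0 f x : Cvx_0y f -> 0 <= f x.
Proof. by case=> [[_ [+ _]]|->]; [exact|rewrite /= leey]. Qed.

Lemma Cvx_0yP f : Cvx_0y f ->
  lower_semicontinuous f /\ convex_efun f.
Proof.
case=> [[+ [f0 _]]|->].
  case=> [[_ []//]|fE]; by have := f0 0%R; rewrite fE.
split=> [x a _|x y t /andP[t0 t1] /=].
  by exists setT; [exact: filterT|move=> y _ /=; rewrite ltry].
have [->|tN0] := eqVneq t 0%R; first by rewrite mul0e subr0 mul1e add0e.
rewrite gt0_muley ?lte_fin ?lt_neqAle 1?eq_sym ?tN0 ?t0//.
by rewrite addye// -ltNye (lt_le_trans _ (mule_ge0 _ (leey _)))// lee_fin subr_ge0.
Qed.

(* A pointwise supremum of elements of [Cvx_0y] vanishing somewhere is again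
   in [Cvx_0y]. *)
Lemma Cvx_0y_sup S h : S `<=` @Cvx_0y R c -> S !=set0 ->
  (forall x, h x = ereal_sup [set f x | f in S]) ->
  (exists x, h x = 0) -> Cvx_0y h.
Proof.
move=> SC [f0 Sf0] hE [z hz].
have fh f x : S f -> f x <= h x.
  by move=> Sf; rewrite hE; apply: ereal_sup_ubound; exists f.
have h0 x : 0 <= h x.
  by apply: le_trans (fh f0 x Sf0); apply/Cvx_0y_ge0/SC.
left; split; last by split=> //; exists z.
left; split=> [x|]; first exact: lt_le_trans (h0 x).
split=> [x a|x y t t01].
  rewrite hE => /ereal_sup_gt[_ [f Sf <-]] afx.
  have [/(_ x a afx)[V xV Vf] _] := Cvx_0yP (SC _ Sf).
  by exists V => // y Vy; apply: lt_le_trans (fh f y Sf); exact: Vf.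
rewrite {1}hE; apply: ge_ereal_sup => _ [f Sf <-].
have [_ /(_ x y t t01) cf] := Cvx_0yP (SC _ Sf).
apply: (le_trans cf); case/andP: t01 => t0 t1.
by rewrite leeD// lee_wpmul2l ?lee_fin ?subr_ge0// fh.
Qed.

Lemma cvx_meetP f g : Cvx_0y f -> Cvx_0y g ->
  let A := @Cvx_0y R c `&` ubound [set f; g] in
  (A `&` lbound A) (cvx_meet f g).
Proof.
move=> Cf Cg A; apply: xgetPex.
have [[z [fz gz]]|noz] := pselect (exists x, f x = 0 /\ g x = 0); last first.
  exists (cst +oo); split; first split; first by right.
    by move=> k _; apply/lefP => x; rewrite leey.
  move=> k [[[_ [_ [z kz]]]|->]// Uk]; exfalso; apply: noz; exists z.
  have /lefP/(_ z) fk := Uk f (or_introl erefl).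
  have /lefP/(_ z) gk := Uk g (or_intror erefl).
  by split; apply/eqP; rewrite eq_le -{1}kz ?fk ?gk Cvx_0y_ge0.
pose h x := ereal_sup [set k x | k in [set f; g]].
have hub k x : [set f; g] k -> k x <= h x.
  by move=> fgk; apply: ereal_sup_ubound; exists k.
exists h; split; first split.
- apply: (@Cvx_0y_sup [set f; g]) => //; first by move=> k [->|->].
    by exists f; left.
  exists z; apply/eqP; rewrite eq_le -{2}fz hub ?andbT; last by left.
  by apply: ge_ereal_sup => _ [k [->|->] <-]; rewrite ?fz ?gz.
- by move=> k fgk; apply/lefP => x; exact: hub.
- move=> k [Ck Uk]; apply/lefP => x.
  by apply: ge_ereal_sup => _ [l fgl <-]; have /lefP := Uk l fgl; exact.
Qed.

Lemma cvx_joinP f g : Cvx_0y f -> Cvx_0y g ->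
  let A := @Cvx_0y R c `&` lbound [set f; g] in
  (A `&` ubound A) (cvx_join f g).
Proof.
move=> Cf Cg A; apply: xgetPex.
have C0 : Cvx_0y (cst 0 : E -> \bar R).
  left; split; last by split=> //; exists 0%R.
  left; split=> [x|]; first exact: ltNy0.
  split=> [x a a0|x y t _ /=]; first by exists setT; [exact: filterT|].
  by rewrite !mule0 adde0.
have A0 : A (cst 0).
  by split=> // k fgk; apply/lefP => x; case: fgk => ->; exact: Cvx_0y_ge0.
pose h x := ereal_sup [set k x | k in A].
have hub k x : A k -> k x <= h x.
  by move=> Ak; apply: ereal_sup_ubound; exists k.
have hlb k x : [set f; g] k -> h x <= k x.
  move=> fgk; apply: ge_ereal_sup => _ [l [_ Ll] <-].
  by have /lefP := Ll k fgk; exact.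
have AC : A `<=` @Cvx_0y R c by move=> k [].
have Lh : lbound [set f; g] h by move=> k fgk; apply/lefP => x; exact: hlb.
have Uh : ubound A h by move=> k Ak; apply/lefP => x; exact: hub.
exists h; split=> //; split=> //.
have hz k : [set f; g] k -> (exists z, k z = 0) -> Cvx_0y h.
  move=> fgk [z kz]; apply: (Cvx_0y_sup AC) => //; first by exists (cst 0).
  by exists z; apply/eqP; rewrite eq_le -{1}kz hlb// (hub (cst 0)).
case: (Cf) => [[_ [_ fz]]|fE]; first by apply: (hz f) => //; left.
case: (Cg) => [[_ [_ gz]]|gE]; first by apply: (hz g) => //; right.
right; apply/funext => x; apply/eqP; rewrite eq_le leey /=.
have /(hub _ x) : A (cst +oo); last by [].
split; first by right.
by move=> k [->|->]; rewrite ?fE ?gE.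
Qed.

End Existence.

(* Main.v *)
(* Write f_C for the image of C. Its zero set z(C) respects intersections, and
   so do the sublevel sets {f_C <= l} below an affine l < f_{}; each such map M
   sends {} to {}. Radon's theorem then transfers the combinatorics of points:
   if b_i lies in M({p_i}) and conv(b_I) meets conv(b_J), then conv(p_I) meets
   conv(p_J), so affinely independent points p_i have affinely independent b_i.
   Since uncountably many points in general position cannot have two-point
   images (c + 1 of them would meet a common rational hyperplane), few values
   M({p}) can have two points.
   If f_{} is not +oo, all the f_C vanish at a common point; if moreover some
   f_{p} differs from f_{}, then for an affine l between them too many of the
   sets {f_q <= l} have two points. So f_{p} = f_{} for all p and the map is
   constant.
   If f_{} = +oo, every z({p}) is a single point b(p). Radon's theorem makes b
   preserve betweenness and non-collinearity, hence harmonic quadruples; with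
   monotonicity along lines this makes b affine, and z(C) = b(C). Finally, if
   f_C were finite at b(q) for some q outside C, intersecting segments would make
   every f_{x} finite at b(q), and then everywhere, contradicting the compactness
   of its domain. *)

Require Import Defs.
From HB Require Import structures.
From mathcomp Require Import all_boot all_order all_algebra finmap.
From mathcomp Require Import all_classical all_reals all_analysis.
From mathcomp Require Import ring lra.

Set Implicit Arguments.
Unset Strict Implicit.
Unset Printing Implicit Defensive.

Import Order.TTheory GRing.Theory Num.Theory.
Import numFieldNormedType.Exports.

Local Open Scope classical_set_scope.
Local Open Scope ring_scope.

(** * Segments and polytopes *)

Lemma convex_setP (R : realType) (V : lmodType R) (A : set V) :
  @convex_set R V A <->
  forall x y t, 0 <= t <= 1 -> A x -> A y -> A (t *: x + (1 - t) *: y).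
Proof.
split=> [cA x y t /andP[t0 t1] Ax Ay|cA x y t /set_mem Ax /set_mem Ay].
  by have /set_mem := cA x y (Itv01 t0 t1) (mem_set Ax) (mem_set Ay).
apply/mem_set; rewrite /conv/=.
by apply: cA => //; rewrite ge0 le1.
Qed.


Section ConvexSets.
Context (R : realType) (c : nat).
Local Notation V := 'rV[R]_c.
Implicit Types (C D : set V) (p q x y : V) (s : seq V).

Lemma compact_convex0 : @compact_convex R c set0.
Proof. by split; [exact: compact0|apply/convex_setP]. Qed.

Lemma compact_convex1 p : compact_convex [set p].
Proof.
split; first exact: compact_set1.
by apply/convex_setP => x y t _ -> ->; rewrite -scalerDl subrKC scale1r.
Qed.

Lemma compact_convexI C D :
  compact_convex C -> compact_convex D -> compact_convex (C `&` D).
Proof.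
move=> [kC /convex_setP cC] [kD /convex_setP cD]; split.
  apply: (subclosed_compact _ kC); last by move=> x [].
  by apply: closedI; apply: compact_closed => //; exact: norm_hausdorff.
apply/convex_setP => x y t t01 [Cx Dx] [Cy Dy].
by split; [exact: cC|exact: cD].
Qed.

Lemma conv_hull_convex (A : set V) : @convex_set R V (conv_hull A).
Proof.
apply/convex_setP => x y t t01 Ax Ay B [cB AB].
by move/convex_setP : (cB); apply => //; [exact: Ax|exact: Ay].
Qed.

Lemma sub_conv_hull (A : set V) : A `<=` conv_hull A.
Proof. exact: sub_gen_smallest. Qed.

Lemma conv_hull_sub (A B : set V) :
  @convex_set R V B -> A `<=` B -> conv_hull A `<=` B.
Proof. by move=> cB AB; exact: smallest_sub. Qed.

(** The points of the required form already make up a convex set: when two of them are mixed, their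
    parts in [C] and their parts in [D] merge separately. *)
Lemma conv_hullE C D x : @convex_set R V C -> @convex_set R V D ->
  C !=set0 -> D !=set0 -> conv_hull (C `|` D) x ->
  exists y z t, [/\ C y, D z, 0 <= t <= 1 & x = t *: y + (1 - t) *: z].
Proof.
move=> /convex_setP cC /convex_setP cD [y0 Cy0] [z0 Dz0].
pose B := [set x | exists y z t,
  [/\ C y, D z, 0 <= t <= 1 & x = t *: y + (1 - t) *: z]].
apply: (@conv_hull_sub _ B) => [|{}x [Cx|Dx]]; last 2 first.
- by exists x, z0, 1; rewrite scale1r subrr scale0r addr0 lexx ler01.
- by exists y0, x, 0; rewrite scale0r subr0 scale1r add0r lexx ler01.
apply/convex_setP => x1 x2 t /andP[t0 t1].
move=> [y1 [z1 [a [Cy1 Dz1 /andP[a0 a1] ->]]]].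
move=> [y2 [z2 [b [Cy2 Dz2 /andP[b0 b1] ->]]]].
pose r := t * a + (1 - t) * b.
have t1' : 0 <= 1 - t by lra.
have r0 : 0 <= r by rewrite addr_ge0// mulr_ge0.
have r1 : r <= 1 by rewrite /r; nra.
(* A nonnegative combination is normalised by its total weight; for total weight 0 any point of the
   set serves. *)
have mix (E : set V) u v k m :
    (forall x y t, 0 <= t <= 1 -> E x -> E y -> E (t *: x + (1 - t) *: y)) ->
    E u -> E v -> 0 <= k -> 0 <= m ->
    exists2 w, E w & k *: u + m *: v = (k + m) *: w.
  move=> cE Eu Ev k0 m0; have [km|km] := eqVneq (k + m) 0.
    have k0' : k = 0 by lra.
    have m0' : m = 0 by lra.
    by exists u => //; rewrite km k0' m0' !scale0r addr0.
  have kmp : 0 < k + m by rewrite lt_neqAle eq_sym km addr_ge0.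
  exists (k / (k + m) *: u + (1 - k / (k + m)) *: v).
    apply: cE => //; rewrite divr_ge0 ?addr_ge0//=.
    by rewrite ler_pdivrMr// mul1r; lra.
  rewrite scalerDr !scalerA; congr (_ *: _ + _ *: _); by field.
have [y Cy Ey] := mix C y1 y2 _ _ cC Cy1 Cy2 (mulr_ge0 t0 a0) (mulr_ge0 t1' b0).
have a1' : 0 <= 1 - a by lra.
have b1' : 0 <= 1 - b by lra.
have [z Dz Ez] :=
  mix D z1 z2 _ _ cD Dz1 Dz2 (mulr_ge0 t0 a1') (mulr_ge0 t1' b1').
exists y, z, r; split => //; first by rewrite r0 r1.
rewrite -Ey (_ : 1 - r = t * (1 - a) + (1 - t) * (1 - b)); last first.
  by rewrite /r; ring.
by rewrite -Ez !scalerDr !scalerA addrACA.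
Qed.

(** For nonempty [C] and [D] the hull is the continuous image of the compact product of [C], [D] and
    the unit interval. *)
Lemma compact_convex_hullU C D : compact_convex C -> compact_convex D ->
  compact_convex (conv_hull (C `|` D)).
Proof.
move=> [kC cC] [kD cD].
have [->|/set0P C0] := eqVneq C set0.
  by rewrite set0U /conv_hull smallest_id.
have [->|/set0P D0] := eqVneq D set0.
  by rewrite setU0 /conv_hull smallest_id.
split; last exact: conv_hull_convex.
pose f (u : V * V * R^o) : V := u.2 *: u.1.1 + (1 - u.2) *: u.1.2.
have -> : conv_hull (C `|` D) = f @` ((C `*` D) `*` `[0, 1]%classic).
  apply/seteqP; split=> [x|].
    move=> /(conv_hullE cC cD C0 D0)[y [z [t [Cy Dz t01 ->]]]].
    by exists (y, z, t) => //; split => //=; rewrite in_itv.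
  move=> _ [[[y z] t] [[/= Cy Dz] +] <-]; rewrite in_itv/= => t01.
  by have /convex_setP := @conv_hull_convex (C `|` D); apply => //;
    apply: sub_conv_hull; [left|right].
apply: continuous_compact; last first.
  exact: (compact_setX (compact_setX kC kD) (@segment_compact R 0 1)).
apply: continuous_subspaceT => u.
apply: cvgD; apply: cvgZ.
- exact: cvg_snd.
- by apply: (@cvg_comp _ _ _ fst fst); [exact: cvg_fst|exact: cvg_fst].
- by apply: cvgB; [exact: cvg_cst|exact: cvg_snd].
- by apply: (@cvg_comp _ _ _ fst snd); [exact: cvg_fst|exact: cvg_snd].
Qed.

(** A segment is written as a join of points, so that a lattice homomorphism can be evaluated on
    it. *)
Definition sgm p q : set V := conv_hull ([set p] `|` [set q]).

Lemma compact_convex_sgm p q : compact_convex (sgm p q).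
Proof. by apply: compact_convex_hullU; exact: compact_convex1. Qed.

Lemma sgmP p q x :
  sgm p q x <-> exists2 t, 0 <= t <= 1 & x = t *: p + (1 - t) *: q.
Proof.
split=> [|[t t01 ->]].
  have c1 y := (compact_convex1 y).2.
  move=> /(conv_hullE (c1 p) (c1 q)); case; [by exists p|by exists q|].
  by move=> _ [_ [t [-> -> t01 ->]]]; exists t.
have /convex_setP := @conv_hull_convex ([set p] `|` [set q]).
by apply => //; apply: sub_conv_hull; [left|right].
Qed.

Lemma sgml p q : sgm p q p.
Proof. by apply: sub_conv_hull; left. Qed.

Lemma sgmr p q : sgm p q q.
Proof. by apply: sub_conv_hull; right. Qed.

Lemma sgm_mid p q : sgm p q (2^-1 *: (p + q)).
Proof.
apply/sgmP; exists 2^-1; first by lra.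
rewrite scalerDr; congr (_ + _ *: _); by field.
Qed.

(** An iterated join of points: bounds on a homomorphism pass from points to polytopes by induction
    on [s]. *)
Definition poly s : set V :=
  foldr (fun p D => conv_hull (D `|` [set p])) set0 s.

Lemma compact_convex_poly s : compact_convex (poly s).
Proof.
elim: s => [|p s IH]; first exact: compact_convex0.
by apply: compact_convex_hullU => //; exact: compact_convex1.
Qed.

Lemma poly_mem s p : p \in s -> poly s p.
Proof.
elim: s => // q s IH; rewrite inE => /predU1P[->|/IH ps];
  apply: (@sub_conv_hull (poly s `|` [set q])); [by right|by left].
Qed.

Lemma poly_comb (I : finType) (P : I -> V) (r : seq I) x :
  poly [seq P i | i <- r] x ->
  exists m : I -> R, [/\ forall i, 0 <= m i, forall i, i \notin r -> m i = 0,
    \sum_i m i = 1 & \sum_i m i *: P i = x].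
Proof.
elim: r x => // j r IH x.
have c1 := (compact_convex1 (P j)).2.
have cr := (compact_convex_poly [seq P i | i <- r]).2.
have sd : \sum_i (i == j)%:R = 1 :> R.
  by rewrite (bigD1 j)//= eqxx big1 ?addr0// => i /negbTE ->.
have sP : \sum_i (i == j)%:R *: P i = P j.
  rewrite (bigD1 j)//= eqxx scale1r big1 ?addr0// => i /negbTE ->.
  by rewrite scale0r.
have [/= e|/set0P r0] := eqVneq (poly [seq P i | i <- r]) set0.
  rewrite /= e set0U /conv_hull smallest_id// => ->.
  exists (fun i => (i == j)%:R); split => // i.
  by rewrite inE negb_or => /andP[/negbTE ->].
move=> /(conv_hullE cr c1 r0) [|y [_ [t [ry -> /andP[t0 t1] ->]]]].
  by exists (P j).
have [m [m0 mr m1 my]] := IH _ ry.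
exists (fun i => t * m i + (1 - t) * (i == j)%:R); split.
- by move=> i; rewrite addr_ge0 ?mulr_ge0// subr_ge0.
- move=> i; rewrite inE negb_or => /andP[/negbTE -> /mr ->].
  by rewrite !mulr0 addr0.
- by rewrite big_split/= -!mulr_sumr m1 sd; ring.
- under eq_bigr do rewrite scalerDl -!scalerA.
  by rewrite big_split/= -!scaler_sumr my sP.
Qed.

Lemma convex_comb (A : set V) (I : finType) (m : I -> R) (P : I -> V) :
  @convex_set R V A -> (forall i, 0 <= m i) -> \sum_i m i = 1 ->
  (forall i, m i != 0 -> A (P i)) -> A (\sum_i m i *: P i).
Proof.
move=> /convex_setP cA m0 m1 AP.
(* Normalising the partial sums keeps them in [A] during the induction on the index list. *)
suff cone (r : seq I) : 0 < \sum_(i <- r) m i ->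
    A ((\sum_(i <- r) m i)^-1 *: \sum_(i <- r) m i *: P i).
  by have := cone (index_enum I); rewrite m1 invr1 scale1r; apply.
elim: r => [|i r IH]; first by rewrite big_nil ltxx.
rewrite !big_cons; set S := \sum_(j <- r) m j; set W := \sum_(j <- r) _ => S0.
have Sr : 0 <= S by exact: sumr_ge0.
have [mi|mi] := eqVneq (m i) 0.
  by rewrite mi scale0r !add0r; apply: IH; move: S0; rewrite mi add0r.
have [S00|SN] := eqVneq S 0.
  have -> : W = 0.
    apply: big1_seq => j /= jr.
    have : m j = 0.
      move: S00 => /eqP; rewrite psumr_eq0// => /allP/(_ _ jr)/eqP; exact.
    by move=> ->; rewrite scale0r.
  by rewrite S00 !addr0 scalerA mulVf// scale1r; exact: AP.
have Sp : 0 < S by rewrite lt_neqAle eq_sym SN.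
have -> : (m i + S)^-1 *: (m i *: P i + W) =
    (m i / (m i + S)) *: P i + (1 - m i / (m i + S)) *: (S^-1 *: W).
  rewrite scalerDr !scalerA; congr (_ *: _ + _ *: _); first by rewrite mulrC.
  by field; rewrite !gt_eqF.
apply: cA; [|exact: AP|exact: IH].
by rewrite divr_ge0 ?(ltW S0)//= ler_pdivrMr// mul1r lerDl.
Qed.

End ConvexSets.

(** * Radon partitions *)

Section MeetMaps.
Context (R : realType) (c : nat).
Local Notation V := 'rV[R]_c.
Implicit Types (C D : set V) (p q x y : V).

Definition affine_dep (I : finType) (b : I -> V) (l : I -> R) : Prop :=
  [/\ exists i, l i != 0, \sum_i l i = 0 & \sum_i l i *: b i = 0].

Lemma left_kernel (m n : nat) (N : 'M[R]_(m, n)) : (n < m)%N ->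
  exists2 v : 'rV_m, v != 0 & v *m N = 0.
Proof.
move=> nm; have : kermx N != 0.
  rewrite -mxrank_eq0 mxrank_ker -lt0n subn_gt0.
  exact: leq_ltn_trans (rank_leq_col N) nm.
move=> /rowV0Pn[v /sub_kermxP vN v0]; by exists v.
Qed.

(** Appending a coordinate 1 to the points turns linear dependences, which exist in dimension
    [c + 1], into affine ones. *)
Lemma affine_dep_exists (I : finType) (b : I -> V) :
  (c.+1 < #|I|)%N -> exists l, affine_dep b l.
Proof.
rewrite -[X in (X < _)%N]addn1 => cI.
pose one : 'rV[R]_1 := const_mx 1.
have [v v0 vN] :=
  left_kernel (\matrix_(i < #|I|) row_mx (b (enum_val i)) one) cI.
exists (fun i => v 0 (enum_rank i)); split.
- have /rV0Pn[j vj] := v0; exists (enum_val j); by rewrite enum_valK.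
- move/rowP: vN => /(_ (rshift c 0)).
  rewrite !mxE (reindex_onto enum_rank enum_val) => [|i _]; last first.
    exact: enum_valK.
  under [X in X = _]eq_bigl do rewrite enum_rankK eqxx.
  by move=> e; rewrite -[RHS]e; apply: eq_bigr => i _;
    rewrite mxE row_mxEr mxE mulr1.
- apply/rowP => j; move/rowP: vN => /(_ (lshift 1 j)).
  rewrite !mxE (reindex_onto enum_rank enum_val) => [|i _]; last first.
    exact: enum_valK.
  under [X in X = _]eq_bigl do rewrite enum_rankK eqxx.
  move=> e; rewrite -[RHS]e summxE; apply: eq_bigr => i _.
  by rewrite mxE [in RHS]mxE row_mxEl enum_rankK.
Qed.

(** With the constant coordinate [k] replaced by 1 there are [c + 1] vectors in dimension [c];
    column [k] then says that the weights sum to 0. *)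
Lemma hyperplane_dep (b : 'I_c.+1 -> V) (k : 'I_c) (r : R) :
  (forall i, b i 0 k = r) -> exists l, affine_dep b l.
Proof.
move=> bk; have [v v0 vN] := left_kernel
  (\matrix_(i < c.+1, j < c) if j == k then 1 else b i 0 j) (ltnSn c).
have v1 : \sum_i v 0 i = 0.
  move/rowP: vN => /(_ k); rewrite !mxE => e; rewrite -[RHS]e.
  by apply: eq_bigr => i _; rewrite mxE eqxx mulr1.
exists (v 0); split => //; first by have /rV0Pn[j vj] := v0; exists j.
apply/rowP => j; rewrite summxE mxE.
have [->|jk] := eqVneq j k.
  by under eq_bigr do rewrite mxE bk; rewrite -mulr_suml v1 mul0r.
move/rowP: vN => /(_ j); rewrite !mxE => e; rewrite -[RHS]e.
by apply: eq_bigr => i _; rewrite !mxE (negbTE jk).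
Qed.

Definition moment (t : R) : V := \row_(j < c) t ^+ j.+1.

(** A dependence would be a kernel vector of an invertible Vandermonde matrix: row 0 is the sum of
    the weights, row [j + 1] is coordinate [j]. *)
Lemma moment_indep (t : 'I_c.+1 -> R) (e : R) p (l : 'I_c.+1 -> R) :
  injective t -> e != 0 -> ~ affine_dep (fun i => p + e *: moment (t i)) l.
Proof.
move=> tI e0 [[i li] l1 lm].
have {}lm : \sum_i l i *: moment (t i) = 0.
  move: lm; under eq_bigr do rewrite scalerDr scalerA mulrC -scalerA.
  rewrite big_split/= -scaler_suml l1 scale0r add0r -scaler_sumr.
  by move=> /eqP; rewrite scaler_eq0 (negbTE e0) => /eqP.
pose a : 'rV[R]_c.+1 := \row_i t i.
have aU : Vandermonde c.+1 a \in unitmx.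
  rewrite unitmxE det_Vandermonde unitfE; apply/prodf_neq0 => j _.
  apply/prodf_neq0 => j' jj'; rewrite !mxE subr_eq0.
  by apply/eqP => /tI ejj; move: jj'; rewrite ejj ltnn.
have : Vandermonde c.+1 a *m (\col_i l i) = 0.
  apply/colP => j; rewrite !mxE.
  case: (unliftP ord0 j) => [j'|] ->.
    move/rowP: lm => /(_ j'); rewrite summxE mxE => em; rewrite -[RHS]em.
    by apply: eq_bigr => k _; rewrite !mxE mulrC.
  by rewrite -[RHS]l1; apply: eq_bigr => k _; rewrite !mxE expr0 mul1r.
move=> /(congr1 (mulmx (invmx (Vandermonde c.+1 a)))).
rewrite mulKmx// mulmx0 => /colP/(_ i); rewrite !mxE => li0.
by move: li; rewrite li0 eqxx.
Qed.

(** The common abstraction of the zero sets and of the sublevel sets of the image functions; see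
    [H_le_meet_map]. *)
Definition meet_map (M : set V -> set V) : Prop :=
  [/\ forall C, compact_convex C -> @convex_set R V (M C),
      forall C D, compact_convex C -> compact_convex D ->
        M (C `&` D) = M C `&` M D
    & M set0 = set0].

Context (M : set V -> set V) (hM : meet_map M).

Lemma meet_map_sub C D : compact_convex C -> compact_convex D ->
  C `<=` D -> M C `<=` M D.
Proof.
move=> cC cD /setIidPl CD; have [_ /(_ _ _ cC cD) + _] := hM.
by rewrite CD => {1}-> x [].
Qed.

Lemma meet_map_inj p q y : M [set p] y -> M [set q] y -> p = q.
Proof.
move=> Mp Mq; apply: contrapT => /eqP pq; have [_ MI M0] := hM.
have : (M [set p] `&` M [set q]) y by [].
rewrite -MI; try exact: compact_convex1.
suff -> : [set p] `&` [set q] = set0 by rewrite M0.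
by apply/seteqP; split => // x [-> /eqP]; rewrite (negbTE pq).
Qed.

Lemma convex_meet_map (I : finType) (P b : I -> V) (m : I -> R) (r : seq I) :
  (forall i, M [set P i] (b i)) -> (forall i, 0 <= m i) -> \sum_i m i = 1 ->
  (forall i, m i != 0 -> i \in r) ->
  M (poly [seq P i | i <- r]) (\sum_i m i *: b i).
Proof.
move=> Mb m0 m1 mr; have cr := compact_convex_poly [seq P i | i <- r].
have [cM _ _] := hM; apply: convex_comb => //; first exact: cM.
move=> i /mr ir; apply: (@meet_map_sub [set P i]) => //.
  exact: compact_convex1.
by move=> _ ->; apply: poly_mem; apply: map_f.
Qed.

Section Radon.
Context (I : finType) (P b : I -> V) (l : I -> R).
Hypotheses (Mb : forall i, M [set P i] (b i)) (dl : affine_dep b l).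

Let pos := poly [seq P i | i <- enum [pred i | 0 < l i]].
Let neg := poly [seq P i | i <- enum [pred i | l i < 0]].

(** The positive and negative parts of [l] have the same total [s] and, after division by [s], give
    the same point; it lies in both [M pos] and [M neg]. *)
Lemma radon_point : exists s, [/\ 0 < s, s = \sum_i Num.max (l i) 0 &
  M (pos `&` neg) (\sum_i (Num.max (l i) 0 / s) *: b i)].
Proof.
have [[i0 li0] l1 lb] := dl; have [_ MI _] := hM.
pose s := \sum_i Num.max (l i) 0.
have lN i : Num.max (- l i) 0 = Num.max (l i) 0 - l i.
  by rewrite /Num.max; case: ltP => ?; case: ltP => ?; lra.
have m0 (z : R) : 0 <= Num.max z 0 by rewrite le_max lexx orbT.
have sN : \sum_i Num.max (- l i) 0 = s.
  by under eq_bigr do rewrite lN; rewrite sumrB l1 subr0.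
have s0 : 0 < s.
  rewrite lt_neqAle eq_sym sumr_ge0// andbT; apply/eqP => s00.
  have z (F : I -> R) : (forall i, 0 <= F i) -> \sum_i F i = 0 -> F i0 = 0.
    move=> F0 /eqP; rewrite psumr_eq0// => /allP/(_ i0).
    by rewrite mem_index_enum => /(_ isT)/eqP.
  have := z _ (fun i => m0 (l i)) s00; rewrite s00 in sN.
  have := z _ (fun i => m0 (- l i)) sN; rewrite lN => + e.
  by rewrite e sub0r => /eqP; rewrite oppr_eq0 (negbTE li0).
have mN (z : R) : Num.max z 0 / s != 0 -> 0 < z.
  rewrite ltNge; apply: contraNN => z0.
  by rewrite /Num.max; case: ltgtP z0 => [_|//|->] _; rewrite mul0r.
exists s; split => //; rewrite MI; try exact: compact_convex_poly.
split.
  apply: convex_meet_map => //.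
  - by move=> i; rewrite divr_ge0// ltW.
  - by rewrite -mulr_suml mulfV// gt_eqF.
  - by move=> i; rewrite mem_enum inE/=; exact: mN.
have -> : \sum_i (Num.max (l i) 0 / s) *: b i =
    \sum_i (Num.max (- l i) 0 / s) *: b i.
  apply/eqP; rewrite -subr_eq0 -sumrB; apply/eqP.
  rewrite (eq_bigr (fun i => s^-1 *: (l i *: b i))) => [|i _].
    by rewrite -scaler_sumr lb scaler0.
  by rewrite -scalerBl scalerA lN; congr (_ *: _); field; rewrite gt_eqF.
apply: convex_meet_map => //.
- by move=> i; rewrite divr_ge0// ltW.
- by rewrite -mulr_suml sN mulfV// gt_eqF.
- by move=> i; rewrite mem_enum inE/= => /mN; rewrite oppr_gt0.
Qed.

(** The weights of [x] in the two hulls have disjoint supports, so their difference is not zero. *)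
Lemma poly_cap_dep x : (pos `&` neg) x -> exists m n : I -> R,
  [/\ [/\ forall i, 0 <= m i, forall i, m i != 0 -> 0 < l i,
          \sum_i m i = 1 & \sum_i m i *: P i = x],
      [/\ forall i, 0 <= n i, forall i, n i != 0 -> l i < 0,
          \sum_i n i = 1 & \sum_i n i *: P i = x] &
      affine_dep P (fun i => m i - n i)].
Proof.
move=> [/poly_comb[m [m0 mr m1 mx]] /poly_comb[n [n0 nr n1 nx]]].
have ml i : m i != 0 -> 0 < l i.
  by apply: contraTT => li; apply/negPn/eqP/mr; rewrite mem_enum.
have nl i : n i != 0 -> l i < 0.
  by apply: contraTT => li; apply/negPn/eqP/nr; rewrite mem_enum.
exists m, n; split=> //; split.
- have [i mi] : exists i, m i != 0.
    apply/existsP; apply: contraPT m1; rewrite negb_exists => /forallP m00.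
    rewrite big1 => [/esym/eqP|i _]; first by rewrite oner_eq0.
    by have := m00 i; rewrite negbK => /eqP.
  exists i; have := ml i mi; have : n i = 0.
    by apply: contrapT => /eqP/nl; have := ml i mi; lra.
  by move=> ->; rewrite subr0.
- by rewrite sumrB m1 n1 subrr.
- by under eq_bigr do rewrite scalerBl; rewrite sumrB mx nx subrr.
Qed.

(** Since [M set0 = set0], the point of [radon_point] forces [pos] and [neg] to meet: a dependence
    of the images pulls back with compatible signs. *)
Lemma radon : exists2 u, affine_dep P u &
  forall i, (0 < u i -> 0 < l i) /\ (u i < 0 -> l i < 0).
Proof.
have [s [s0 _ My]] := radon_point; have [_ _ M0] := hM.
have [x /poly_cap_dep[m [n [[m0 ml _ _] [n0 nl _ _] d]]]] :
    exists x, (pos `&` neg) x.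
  apply/set0P; apply: contraPneq My => ->; by rewrite M0.
exists (fun i => m i - n i) => // i; split=> ui.
  by apply: ml; have := n0 i; lra.
by apply: nl; have := m0 i; lra.
Qed.

End Radon.

End MeetMaps.

(** * One-point images *)

(** Countable sets have Lebesgue measure 0. *)
Lemma uncountable_itvoo (R : realType) (a b : R) : a < b ->
  ~ countable (`]a, b[%classic : set R).
Proof.
move=> ab /countable_lebesgue_measure0/eqP.
by rewrite lebesgue_measure_itv/= lte_fin ab -EFinD eqe subr_eq0 gt_eqF.
Qed.

Lemma big_optionE (S : nmodType) (T : finType) (F : option T -> S) :
  \sum_o F o = F None + \sum_i F (Some i).
Proof.
rewrite (bigD1 None)//=; congr (_ + _).
rewrite (reindex_omap Some id) => [|[i|]//]; apply: eq_bigl => i.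
by rewrite eqxx.
Qed.

Section Singletons.
Context (R : realType) (c : nat).
Local Notation V := 'rV[R]_c.
Implicit Types (C D : set V) (p q x y : V).

Definition independent3 (p q r : V) : Prop := forall s t : R,
  s *: (q - p) + t *: (r - p) = 0 -> s = 0 /\ t = 0.

Context (M : set V -> set V) (hM : meet_map M).

(** A linear relation between [b - a] and [d - a] is an affine dependence of the images, with weight
    [- (s + t)] at [a], which [radon] pulls back. *)
Lemma meet_map_independent3 (p q r a b d : V) :
  M [set p] a -> M [set q] b -> M [set r] d ->
  independent3 p q r -> independent3 a b d.
Proof.
move=> Ma Mb Md ipqr s t st; apply: contrapT => st0.
pose P (o : option bool) := if o is Some e then if e then q else r else p.
pose B (o : option bool) := if o is Some e then if e then b else d else a.
pose l (o : option bool) :=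
  if o is Some e then if e then s else t else - (s + t).
have sumE (S : nmodType) (F : option bool -> S) :
    \sum_o F o = F None + (F (Some true) + F (Some false)).
  by rewrite big_optionE big_bool.
have MB o : M [set P o] (B o) by case: o => [[]|].
have dB : affine_dep B l.
  split.
  - have [s0|s0] := eqVneq s 0; last by exists (Some true).
    exists (Some false); apply: contra_notN st0 => /eqP t0; by split.
  - by rewrite sumE/=; ring.
  - rewrite sumE/= -[RHS]st; apply/rowP => k; rewrite !mxE; ring.
have [u [[i ui] u1 uP] _] := radon hM MB dB.
rewrite sumE in u1; rewrite sumE/= in uP.
have [] := ipqr (u (Some true)) (u (Some false)).
  have uN : u None = - (u (Some true) + u (Some false)) by lra.
  rewrite -[RHS]uP uN.
  by apply/rowP => k; rewrite !mxE; ring.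
move=> u2 u3; case: i ui => [[]|]; rewrite ?u2 ?u3 ?eqxx//.
by rewrite (_ : u None = 0) ?eqxx//; lra.
Qed.

(** The first two coordinates give a Vandermonde system of size 2. *)
Lemma moment_independent3 p (s t e : R) : (1 < c)%N -> s != 0 -> t != 0 ->
  s != t -> e != 0 ->
  independent3 p (p + e *: moment c s) (p + e *: moment c t).
Proof.
move=> c1 s0 t0 st e0 a b /rowP ab.
have e1 := ab (Ordinal (ltnW c1)); have e2 := ab (Ordinal c1).
rewrite !mxE/= expr1 expr1 in e1; rewrite !mxE/= in e2.
have {}e1 : e * (a * s + b * t) = 0 by rewrite -[RHS]e1; ring.
have {}e2 : e * (a * s ^+ 2 + b * t ^+ 2) = 0 by rewrite -[RHS]e2; ring.
move/eqP: e1; rewrite mulf_eq0 (negbTE e0)/= => /eqP e1.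
move/eqP: e2; rewrite mulf_eq0 (negbTE e0)/= => /eqP e2.
have : a * (s * (s - t)) = 0.
  rewrite (_ : _ * _ = (a * s ^+ 2 + b * t ^+ 2) - t * (a * s + b * t)).
    by rewrite e1 e2; ring.
  by ring.
move/eqP; rewrite !mulf_eq0 (negbTE s0) subr_eq0 (negbTE st) !orbF => /eqP a0.
move: e1; rewrite a0 mul0r add0r => /eqP.
by rewrite mulf_eq0 (negbTE t0) orbF => /eqP.
Qed.

(* Uncountably many points of a (scaled) moment curve with two-point images
   would yield c + 1 of them whose images contain points on one common
   hyperplane [x_k = q], contradicting [radon]. *)
Lemma fat_countable p (D : set R) (sg : R -> bool) :
  (forall t, D t -> exists y z,
    [/\ M [set p + (-1) ^+ sg t *: moment c t] y,
        M [set p + (-1) ^+ sg t *: moment c t] z & y <> z]) ->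
  countable D.
Proof.
move=> fat.
(* Parameters are classed by sign, coordinate and rational value. There are countably many classes,
   and each is shown to be finite. *)
pose F (h : bool * ('I_c * rat)) := [set t | D t /\ sg t = h.1 /\
  exists2 a, M [set p + (-1) ^+ h.1 *: moment c t] a & a 0 h.2.1 = ratr h.2.2].
have -> : D = \bigcup_h F h.
  apply/seteqP; split=> [t Dt|t [h _ []//]].
  have [y [z [My Mz yz]]] := fat t Dt.
  have [k yzk] : exists k, y 0 k != z 0 k.
    apply: contra_notP yz => /forallNP yz; apply/rowP => k.
    by have /negP := yz k; rewrite negbK => /eqP.
  wlog yz0 : y z My Mz {yz yzk} / y 0 k < z 0 k.
    move=> wl; move: yzk; rewrite neq_lt => /orP[]; exact: wl.
  have [q] := rat_in_itvoo yz0; rewrite in_itv/= => /andP[yq qz].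
  exists (sg t, (k, q)) => //; split => //; split => //=.
  have [cM _ _] := hM.
  have /convex_setP cx :=
    cM _ (compact_convex1 (p + (-1) ^+ sg t *: moment c t)).
  pose s := (z 0 k - ratr q) / (z 0 k - y 0 k).
  exists (s *: y + (1 - s) *: z).
    apply: cx => //; rewrite /s divr_ge0/= ?subr_ge0 ?(ltW qz) ?(ltW yz0)//.
    by rewrite ler_pdivrMr ?subr_gt0// mul1r lerD2l lerN2 ltW.
  by rewrite !mxE /s; field; rewrite subr_eq0 gt_eqF.
apply: bigcup_countable => // h _; apply: finite_set_countable.
apply: contrapT => /(infinite_set_fset c.+1)[B BF cB].
pose t (i : 'I_c.+1) := nth 0 B i.
have iB (i : 'I_c.+1) : (i < size B)%N.
  exact: leq_trans (ltn_ord i) cB.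
have tI : injective t.
  move=> i j /eqP; rewrite nth_uniq ?fset_uniq//; last first.
  by move=> /eqP/val_inj.
have Ft i : F h (t i) by apply: BF; rewrite /= mem_nth.
have /choice[b Mb] : forall i, exists a,
    M [set p + (-1) ^+ h.1 *: moment c (t i)] a /\ a 0 h.2.1 = ratr h.2.2.
  move=> i; have [_ [_ [a]]] := Ft i; by exists a.
have [l dl] := hyperplane_dep (fun i => (Mb i).2).
have [u du _] := radon hM (fun i => (Mb i).1) dl.
by apply: (moment_indep tI _ du); rewrite signr_eq0.
Qed.

Hypothesis M_neq0 : forall q, M [set q] !=set0.

(* A simplex through [t *: p + (1 - t) *: u] in a hyperplane transversal to
   [p - u] meets the segment from [p] to [u] in this point only, and in
   general position: the Radon partition of these c + 2 points is unique. *)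
Lemma meet_map_between p u a d (t : R) : p != u -> 0 < t < 1 ->
  M [set p] a -> M [set u] d ->
  exists2 s, 0 < s < 1 &
    M [set t *: p + (1 - t) *: u] (s *: a + (1 - s) *: d).
Proof.
move=> pu /andP[t0 t1] Ma Md; set x := t *: p + (1 - t) *: u.
have [j vj] : exists j, p 0 j - u 0 j != 0.
  move: pu; rewrite -subr_eq0 => /rV0Pn[j]; rewrite !mxE; by exists j.
(* The vectors [w i] span the hyperplane of vanishing coordinate [j], and their only linear
   relation, up to a factor, is that their sum is 0. So [x] is the centroid of the simplex with
   vertices [x + w i]. *)
pose w (i : 'I_c) : V :=
  \row_k (if k == j then 0 else if i == j then - 1 else (i == k)%:R).
have /choice[q Mq] : forall i, exists y, M [set x + w i] y.
  by move=> i; exact: M_neq0.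
pose I := option (option 'I_c).
pose P (o : I) :=
  if o is Some o' then if o' is Some i then x + w i else u else p.
pose b (o : I) := if o is Some o' then if o' is Some i then q i else d else a.
have Mb o : M [set P o] (b o) by case: o => [[]|].
have sumE (S : nmodType) (F : I -> S) :
    \sum_o F o = F None + (F (Some None) + \sum_i F (Some (Some i))).
  by rewrite !big_optionE.
have vec (n : I -> R) : \sum_o n o *: P o - (\sum_o n o) *: x =
    (n None * (1 - t) - n (Some None) * t) *: (p - u)
      + \sum_i n (Some (Some i)) *: w i.
  rewrite !sumE/=.
  under [X in _ + (_ + X) - _]eq_bigr do rewrite scalerDr.
  rewrite big_split/= -scaler_suml.
  set W := \sum_i _ *: w i; set N := \sum_i n _.
  by rewrite /x; apply/rowP => k; rewrite !mxE; ring.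
have balanced (n : I -> R) : affine_dep P n ->
    n None * (1 - t) = n (Some None) * t /\
    forall i, n (Some (Some i)) = n (Some (Some j)).
  move=> [_ n1 nP]; move: (vec n); rewrite n1 nP scale0r subr0 => /esym/rowP nE.
  have e1 : n None * (1 - t) - n (Some None) * t = 0.
    have := nE j; rewrite !mxE summxE big1 ?addr0 => [|i _]; last first.
      by rewrite !mxE eqxx mulr0.
    by move/eqP; rewrite mulf_eq0 (negbTE vj) orbF => /eqP.
  split=> [|i]; first exact: subr0_eq.
  have [->//|ij] := eqVneq i j.
  have := nE i; rewrite e1 scale0r add0r summxE (bigD1 j)//= (bigD1 i)//= big1.
    rewrite !mxE (negbTE ij) eq_sym (negbTE ij) !eqxx (_ : true%:R = 1)//.
    by lra.
  move=> k /andP[kj ki].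
  by rewrite !mxE (negbTE ij) (negbTE kj) (negbTE ki) mulr0.
(* By [balanced] a dependence is determined by its common weight [e] on the simplex: the weights at
   [p] and [u] are [- e * c * t] and [- e * c * (1 - t)]. *)
have signs (n : I -> R) : affine_dep P n ->
    0 < n None /\ 0 < n (Some None) /\ (forall i, n (Some (Some i)) < 0) \/
    n None < 0 /\ n (Some None) < 0 /\ (forall i, 0 < n (Some (Some i))).
  move=> dn; have [e1 e2] := balanced n dn; have [[i0 ni0] n1 _] := dn.
  move: n1; rewrite sumE (eq_bigr (fun=> n (Some (Some j)))); last by [].
  rewrite sumr_const card_ord -mulr_natr; set e := n (Some (Some j)) => n1.
  have c0 : 0 < c%:R :> R by rewrite ltr0n; exact: leq_ltn_trans (ltn_ord j).
  have n0 : n None = - (e * (c%:R * t)).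
    have : (n None + (n (Some None) + e * c%:R)) * t = 0 by rewrite n1 mul0r.
    by lra.
  have n2 : n (Some None) = - (e * (c%:R * (1 - t))).
    have : (n None + (n (Some None) + e * c%:R)) * (1 - t) = 0.
      by rewrite n1 mul0r.
    by lra.
  have ct : 0 < c%:R * t by rewrite mulr_gt0.
  have ct' : 0 < c%:R * (1 - t) by rewrite mulr_gt0 ?subr_gt0.
  rewrite n0 n2 !oppr_gt0 !oppr_lt0 !(pmulr_llt0 _ ct) !(pmulr_llt0 _ ct').
  rewrite !(pmulr_lgt0 _ ct) !(pmulr_lgt0 _ ct').
  have [e0|e0|e0] := ltgtP e 0.
  - by left; split=> //; split=> // i; rewrite e2.
  - by right; split=> //; split=> // i; rewrite e2.
  - rewrite e0 !mul0r oppr0 in n0 n2.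
    by case: i0 ni0 => [[i|]|]; rewrite ?e2 -/e ?e0 ?n0 ?n2 eqxx.
(* The [c + 2] images are dependent; [radon] compares the signs with those of the unique dependence
   of [P], and negating [l] if necessary makes the weights of [a] and [d] positive. *)
have [l dl [lp [lu lq]]] : exists2 l, affine_dep b l &
    0 < l None /\ 0 < l (Some None) /\ forall i, l (Some (Some i)) < 0.
  have [l dl] : exists l, affine_dep b l.
    by apply: affine_dep_exists; rewrite !card_option card_ord.
  have [n dn nl] := radon hM Mb dl.
  have [[n1 [n2 n3]]|[n1 [n2 n3]]] := signs n dn.
    exists l => //; split; first exact: (nl _).1.
    by split=> [|i]; [exact: (nl _).1|exact: (nl _).2].
  exists (fun o => - l o).
    have [[i0 li0] l1 lb] := dl; split.
    - by exists i0; rewrite oppr_eq0.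
    - by rewrite sumrN l1 oppr0.
    - by under eq_bigr do rewrite scaleNr; rewrite sumrN lb oppr0.
  rewrite !oppr_gt0; split; first exact: (nl _).2.
  by split=> [|i]; [exact: (nl _).2|rewrite oppr_lt0; exact: (nl _).1].
have [s [s0 sE My]] := radon_point hM Mb dl.
have lmax : \sum_o Num.max (l o) 0 = l None + l (Some None).
  rewrite sumE big1 => [|i _]; last by apply/max_idPr/ltW.
  by rewrite addr0; congr (_ + _); apply/max_idPl/ltW.
exists (l None / s).
  by rewrite divr_gt0//= ltr_pdivrMr// mul1r sE lmax ltrDl.
have -> : l None / s *: a + (1 - l None / s) *: d =
    \sum_o (Num.max (l o) 0 / s) *: b o.
  rewrite sumE/= big1 => [|i _]; last first.
    by rewrite (_ : Num.max _ 0 = 0) ?mul0r ?scale0r//; apply/max_idPr/ltW.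
  rewrite addr0 !(max_idPl _) ?ltW//; congr (_ + _ *: _).
  have -> : l (Some None) = s - l None by rewrite sE lmax; ring.
  by field; rewrite gt_eqF.
apply: (meet_map_sub hM _ (compact_convex1 x) _ My).
  by apply: compact_convexI; exact: compact_convex_poly.
(* It remains to see that [x] is the only common point of the segment and the simplex. *)
move=> y /poly_cap_dep[m [n [[_ ml m1 my] [_ nl _ _] /balanced[/= e _]]]].
have n0 o : 0 < l o -> n o = 0.
  by move=> lo; apply: contrapT => /eqP/nl; lra.
have m0 i : m (Some (Some i)) = 0.
  by apply: contrapT => /eqP/ml; have := lq i; lra.
rewrite (n0 None)// (n0 (Some None))// !subr0 in e.
apply/eqP; rewrite -subr_eq0 -[x]scale1r -m1 -my vec e subrr scale0r add0r.
by rewrite big1// => i _; rewrite m0 scale0r.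
Qed.

(** The point [p + moment c t] is the midpoint of [p] and [u t]. If [M [set p]] contained [a <> d],
    [meet_map_between] would give its image two points, unless [b (u t)] lies on the line through
    [a] and [d]. By [meet_map_independent3] this exception occurs for at most one [t != 0], which
    contradicts [fat_countable]. *)
Lemma meet_map_singleton p a d : (1 < c)%N ->
  M [set p] a -> M [set p] d -> a = d.
Proof.
move=> c1 Ma Md; apply: contrapT => ad.
have [b Mb] := choice M_neq0.
pose u t := p + 2 *: moment c t.
pose D := [set t | t != 0 /\ ~ exists s, b (u t) = a + s *: (d - a)].
have u2 : 2 != 0 :> R by rewrite pnatr_eq0.
have up t : t != 0 -> p != u t.
  move=> t0; rewrite /u eq_sym -subr_eq0 addrC addKr scaler_eq0 (negbTE u2)/=.
  by apply/rV0Pn; exists (Ordinal (ltnW c1)); rewrite mxE expr1.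
have : countable D.
  apply: (@fat_countable p D (fun=> false)) => t [t0 bl].
  have half : 0 < (2^-1 : R) < 1 by lra.
  have [s /andP[s0 s1] My] := meet_map_between (up _ t0) half Ma (Mb (u t)).
  have [r /andP[r0 r1] Mz] := meet_map_between (up _ t0) half Md (Mb (u t)).
  have E : 2^-1 *: p + (1 - 2^-1) *: u t = p + (-1) ^+ false *: moment c t.
    by apply/rowP => k; rewrite !mxE; field.
  rewrite !E in My Mz.
  exists (s *: a + (1 - s) *: b (u t)), (r *: d + (1 - r) *: b (u t)).
  split=> // e.
  have [rs|rs] := eqVneq r s.
    apply: ad; move: e; rewrite rs => /addIr/scalerI; apply; by rewrite gt_eqF.
  (* Equality of the two points, solved for [b (u t)], puts it on the line through [a] and [d]. *)
  apply: bl; exists (r / (r - s)).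
  move/rowP: e => e; apply/rowP => k; have := e k; rewrite !mxE => {}e.
  have rs0 : r - s != 0 by rewrite subr_eq0.
  apply: (mulfI rs0).
  have -> : (r - s) * (a ord0 k + r / (r - s) * (d ord0 k - a ord0 k)) =
    (r - s) * a ord0 k + r * (d ord0 k - a ord0 k) by field.
  by lra.
suff : countable (~` D).
  move=> cDC cD; apply: (@uncountable_itvoo R _ _ ltr01).
  apply: (sub_countable (subset_card_le (@subsetT _ _))).
  rewrite -(setUv D) -bigcup2E; apply: bigcup_countable => //.
  by move=> [//|[//|i]] _; exact: countable0.
have bad s t : t != 0 -> s != 0 -> ~ D s -> ~ D t -> s = t.
  move=> t0 s0 /not_andP[//|/contrapT[r er]] /not_andP[//|/contrapT[k ek]].
  apply: contrapT => /eqP st.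
  have i3 := moment_independent3 (p := p) c1 s0 t0 st u2.
  have i3b := meet_map_independent3 Ma (Mb (u s)) (Mb (u t)) i3.
  have [|_ /eqP] := i3b k (- r).
    by rewrite er ek; apply/rowP => j; rewrite !mxE; ring.
  rewrite oppr_eq0 => /eqP r0.
  move: (up _ s0); rewrite (meet_map_inj hM Ma (y := a) (q := u s)) ?eqxx//.
  by have := Mb (u s); rewrite er r0 scale0r addr0.
have [[t [t0 Dt]]|none] := pselect (exists t, t != 0 /\ ~ D t).
  apply: (@sub_countable _ _ _ ([set 0; t])); last first.
    by apply: finite_set_countable; exact: finite_set2.
  apply: subset_card_le => s Ds; have [->|s0] := eqVneq s 0; [by left|right].
  exact: bad.
apply: (@sub_countable _ _ _ [set 0]); last first.
  by apply: finite_set_countable; exact: finite_set1.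
apply: subset_card_le => s Ds /=; apply/eqP; apply: contra_notT none => s0.
by exists s.
Qed.

End Singletons.

(** * Harmonic maps of the line *)

Section Harmonic.
Context (R : realType).

(** The parameters [z] and [w = z / (2 * z - 1)] satisfy [z + w = 2 * z * w]: they mark points
    harmonically conjugate with respect to [x] and [y]. The equation is the same relation for the
    values, cleared of denominators. *)
Definition harmonic_map (g : R -> R) : Prop := forall x y z, x != y ->
  2^-1 < z < 1 ->
  2 * (g (x + z * (y - x)) - g x) * (g (x + z / (2 * z - 1) * (y - x)) - g x) =
  (g y - g x) *
    (g (x + z * (y - x)) + g (x + z / (2 * z - 1) * (y - x)) - 2 * g x).

(* If [g m] were below the mean [s] of [g (m - h)] and [g (m + h)], then [g]
   would jump over [(g m, s)] at [m]; harmonic conjugation carries this jump to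
   every [w > m], and a rational in each jump makes an interval countable. *)
Lemma harmonic_map_midpoint_le (g : R -> R) :
  {homo g : s t / s < t} -> harmonic_map g ->
  forall m h, 0 < h -> g (m - h) + g (m + h) <= 2 * g m.
Proof.
move=> gI gH m h h0; rewrite leNgt; apply/negP => gm.
pose s := (g (m - h) + g (m + h)) / 2.
have hm : g (m - h) < g (m + h) by apply: gI; lra.
have sm : g m < s by rewrite /s; lra.
(* For [t] between [m] and [m + h], the conjugate [W] of [t] with respect to [m - h] and [m + h]
   lies beyond [m + h]. So [g W] exceeds [g (m + h)], and the harmonic relation forces [g t] above
   the mean. *)
have gap t : m < t -> s <= g t.
  move=> mt; have [th|th] := leP (m + h) t.
    have : g (m + h) <= g t.
      by move: th; rewrite le_eqVlt => /predU1P[->|/gI/ltW].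
    by rewrite /s; lra.
  pose z := 2^-1 + (t - m) / (2 * h).
  have z1 : 2^-1 < z < 1.
    rewrite ltrDl divr_gt0/= ?subr_gt0 ?mulr_gt0//.
    by rewrite /z -ltrBrDl ltr_pdivrMr ?mulr_gt0//; lra.
  have xy : m - h != m + h by rewrite lt_eqF//; lra.
  have := gH _ _ _ xy z1; set W := m - h + _ / _ * _.
  have -> : m - h + z * (m + h - (m - h)) = t.
    by rewrite /z; field; rewrite gt_eqF.
  have yW : g (m + h) < g W.
    apply: gI; rewrite /W -subr_gt0.
    have -> : m - h + z / (2 * z - 1) * (m + h - (m - h)) - (m + h) =
       2 * h * ((1 - z) / (2 * z - 1)) by field; lra.
    by rewrite mulr_gt0 ?divr_gt0//; lra.
  have gt0 : g (m - h) < g t by apply: gI; lra.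
  move=> e; rewrite /s; nra.
have jump w : m < w -> exists2 S, S < g w & forall w', w' < w -> g w' <= S.
  (* These [x] and [y] make [w] the harmonic conjugate of [m], with parameters 3/4 and 3/2. *)
  move=> mw; pose d := w - m; pose x := m - d; pose y := m + d / 3.
  have d0 : 0 < d by rewrite subr_gt0.
  have xy : x < y by rewrite /x /y; lra.
  have xyE : y - x = 4 / 3 * d by rewrite /x /y; field.
  have my : m < y by rewrite /y; lra.
  have xm : x < m by rewrite /x; lra.
  have yw : y < w by rewrite /y /d; lra.
  have [gxm gmy gyw] := And3 (gI _ _ xm) (gI _ _ my) (gI _ _ yw).
  have := gH x y (3 / 4); rewrite lt_eqF// => /(_ isT).
  have -> : x + 3 / 4 * (y - x) = m by rewrite xyE /x; field.
  have -> : x + 3 / 4 / (2 * (3 / 4) - 1) * (y - x) = w.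
    by rewrite xyE /x /d; field.
  set A := g m - g x; set D := g y - g x .
  move=> /(_ ltac:(lra)) e.
  pose B := g w - g x.
  have {}e : 2 * A * B = D * (A + B) by rewrite /A /B e; ring.
  have D0 : 0 < D by rewrite subr_gt0; lra.
  have A0 : 0 < A by rewrite subr_gt0.
  have BD : D < B by rewrite /D /B; lra.
  have AD : D < 2 * A by nra.
  pose q := s - g x.
  have Aq : A < q by rewrite /A /q; lra.
  have qD : q <= D by rewrite /D /q lerD2r; exact: gap.
  have q2 : 0 < 2 * q - D by lra.
  (* This is the conjugate of the value [s] with respect to [g x] and [g y]. Conjugation reverses
     order, so [g m < s] puts [g w] above it. *)
  exists (g x + D * q / (2 * q - D)).
    rewrite -ltrBrDl -/B ltr_pdivrMr//.
    have : (2 * A - D) * (B * (2 * q - D) - D * q) = D ^+ 2 * (q - A).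
      have -> : (2 * A - D) * (B * (2 * q - D) - D * q) =
        (2 * A * B - D * B) * (2 * q - D) - (2 * A - D) * (D * q) by ring.
      by rewrite e; ring.
    move=> e2; rewrite -subr_gt0 -(pmulr_rgt0 _ (x := 2 * A - D)) ?subr_gt0//.
    by rewrite e2 mulr_gt0 ?subr_gt0// exprn_gt0.
  move=> w' w'w; have [w'y|yw'] := leP w' y.
    have gw' : g w' <= g y.
      by move: w'y; rewrite le_eqVlt => /predU1P[->|/gI/ltW].
    apply: le_trans gw' _; rewrite -lerBlDl -/D ler_pdivlMr//.
    by rewrite ler_pM2l//; lra.
  (* Conjugation is an involution: [z] marks the conjugate of [w'], which lies beyond [m], so that
     [gap] applies to it. *)
  pose o := (w' - x) / (y - x); pose z := o / (2 * o - 1).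
  have yx0 : 0 < y - x by rewrite subr_gt0.
  have o1 : 1 < o by rewrite /o ltr_pdivlMr// mul1r; lra.
  have o2 : o < 3 / 2.
    by rewrite /o ltr_pdivrMr// xyE; rewrite /x /d in w'w *; lra.
  have z34 : 3 / 4 < z by rewrite /z ltr_pdivlMr; lra.
  have z1 : z < 1 by rewrite /z ltr_pdivrMr; lra.
  have := gH x y z; rewrite lt_eqF// => /(_ isT)/(_ ltac:(lra)).
  have -> : z / (2 * z - 1) = o.
    by rewrite /z; field; rewrite !gt_eqF//; lra.
  have -> : x + o * (y - x) = w' by rewrite /o; field; rewrite gt_eqF.
  have zm : m < x + z * (y - x).
    have -> : m = x + 3 / 4 * (y - x) by rewrite xyE /x; field.
    by rewrite ltrD2l ltr_pM2r.
  have := gap _ zm; set gZ := g (x + _) => sZ.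
  pose A' := gZ - g x; pose B' := g w' - g x => e'.
  have {}e' : 2 * A' * B' = D * (A' + B') by rewrite /A' /B' e' /D; ring.
  rewrite -lerBlDl -/B' ler_pdivlMr//.
  have qA' : q <= A' by rewrite lerD2r.
  have : (2 * A' - D) * (D * q - B' * (2 * q - D)) = D ^+ 2 * (A' - q).
    have -> : (2 * A' - D) * (D * q - B' * (2 * q - D)) =
      (2 * A' - D) * (D * q) - (2 * A' * B' - D * B') * (2 * q - D) by ring.
    by rewrite e'; ring.
  move=> e2; rewrite -subr_ge0 -(pmulr_rge0 _ (x := 2 * A' - D)); last by lra.
  by rewrite e2 mulr_ge0 ?subr_ge0// exprn_ge0// ltW.
have /choice[r rP] : forall w, exists r : rat,
    m < w -> ratr r < g w /\ forall w', w' < w -> g w' < ratr r.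
  move=> w; have [/jump[S Sw gS]|_] := ltP m w; last by exists 0.
  have [r] := rat_in_itvoo Sw; rewrite in_itv/= => /andP[Sr rw].
  by exists r => _; split=> // w' /gS; lra.
apply: (@uncountable_itvoo R m (m + 1)); first by lra.
apply/countable_injP; exists (choice.pickle \o r) => u v.
rewrite !inE/= !in_itv/= => /andP[mu _] /andP[mv _].
move=> /(pcan_inj choice.pickleK) ruv.
have [ru gu] := rP u mu; have [rv gv] := rP v mv; rewrite ruv in ru gu.
by apply/eqP; rewrite eq_le !leNgt; apply/andP; split; apply/negP;
  [move/gu|move/gv]; lra.
Qed.

(** The reverse inequality is the previous lemma for the map sending [t] to [- g (- t)]. *)
Lemma harmonic_map_midpoint (g : R -> R) :
  {homo g : s t / s < t} -> harmonic_map g ->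
  forall m h, 0 < h -> g (m - h) + g (m + h) = 2 * g m.
Proof.
move=> gI gH m h h0; apply/eqP; rewrite eq_le harmonic_map_midpoint_le//=.
pose f t := - g (- t).
have fI : {homo f : s t / s < t} by move=> s t st; rewrite ltrN2 gI// ltrN2.
have fH : harmonic_map f.
  move=> x y z xy z1; have Nxy : - x != - y by rewrite eqr_opp.
  have := gH _ _ _ Nxy z1; rewrite /f.
  have E k : - x + k * (- y - - x) = - (x + k * (y - x)) by ring.
  by rewrite !E; lra.
have := harmonic_map_midpoint_le fI fH (- m) h0; rewrite /f.
rewrite opprK (_ : - (- m - h) = m + h); last by ring.
by rewrite (_ : - (- m + h) = m - h); [lra|ring].
Qed.

(** The midpoint equation gives additivity, hence the identity on rationals; monotonicity extends it
    to the reals. *)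
Lemma midpoint_id (g : R -> R) : {homo g : s t / s < t} ->
  (forall m h, 0 < h -> g (m - h) + g (m + h) = 2 * g m) ->
  g 0 = 0 -> g 1 = 1 -> forall t, g t = t.
Proof.
move=> gI gM g0 g1.
have {}gM m h : g (m - h) + g (m + h) = 2 * g m.
  have [h0|h0|<-] := ltgtP 0 h; first exact: gM.
    by have := gM m (- h); rewrite opprK oppr_gt0 addrC; apply.
  by rewrite subr0 addr0; ring.
have gD s t : g (s + t) = g s + g t.
  have := gM ((s + t) / 2) ((s - t) / 2).
  have := gM ((s + t) / 2) ((s + t) / 2).
  rewrite subrr g0 -splitr (_ : (s + t) / 2 - (s - t) / 2 = t); last by field.
  rewrite (_ : (s + t) / 2 + (s - t) / 2 = s); last by field.
  by lra.
have gN t : g (- t) = - g t.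
  by have := gD t (- t); rewrite subrr g0; lra.
have gn n t : g (t *+ n) = g t *+ n.
  by elim: n => [|n IH]; rewrite ?mulr0n// !mulrSr gD IH.
have gz z : g z%:~R = z%:~R.
  case: z => n; first by rewrite gn g1.
  by rewrite NegzE mulrNz gN gn g1.
have gr q : g (ratr q) = ratr q.
  have d0 : (denq q)%:~R != 0 :> R by rewrite intr_eq0 denq_neq0.
  have dn : (`|denq q|%N)%:R = (denq q)%:~R :> R.
    by rewrite -[denq q in RHS]absz_denq.
  have e : ratr q *+ `|denq q|%N = (numq q)%:~R :> R.
    by rewrite -mulr_natr dn /ratr divfK.
  have := gn `|denq q|%N (ratr q); rewrite e gz -mulr_natr dn => {}e.
  by apply: (mulIf d0); rewrite -e /ratr divfK.
move=> t; apply/eqP; rewrite eq_le !leNgt; apply/andP; split; apply/negP.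
  move=> /rat_in_itvoo[q]; rewrite in_itv/= => /andP[/gI]; rewrite gr; lra.
move=> /rat_in_itvoo[q]; rewrite in_itv/= => /andP[gtq /gI]; rewrite gr; lra.
Qed.

End Harmonic.

(** * Betweenness-preserving maps *)

Section Betweenness.
Context (R : realType) (c : nat).
Local Notation V := 'rV[R]_c.
Implicit Types (p q x y v : V).
Context (b : V -> V).
Hypotheses (c_gt1 : (1 < c)%N) (b_inj : injective b).
Hypothesis b_between : forall p q t, p != q -> 0 < t < 1 ->
  exists2 s, 0 < s < 1 & b (t *: p + (1 - t) *: q) = s *: b p + (1 - s) *: b q.
Hypothesis b_independent3 : forall p q r, independent3 p q r ->
  independent3 (b p) (b q) (b r).

Lemma independent3_exists v : v != 0 ->
  exists e, forall s t : R, s *: v + t *: e = 0 -> s = 0 /\ t = 0.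
Proof.
move=> /rV0Pn[j vj].
have [i ij] : exists i : 'I_c, i != j.
  have [j0|j0] := eqVneq (val j) 0%N.
    by exists (Ordinal c_gt1); rewrite -val_eqE/= j0.
  by exists (Ordinal (ltnW c_gt1)); rewrite -val_eqE/= eq_sym.
exists (delta_mx 0 i) => s t /rowP st.
have := st j; rewrite !mxE eqxx/= (negbTE (_ : j != i)); last by rewrite eq_sym.
rewrite mulr0 addr0 => /eqP; rewrite mulf_eq0 (negbTE vj) orbF => /eqP s0.
by have := st i; rewrite !mxE !eqxx s0 mul0r add0r mulr1.
Qed.

(* The complete quadrilateral on [x], [y], [r] constructing the harmonic
   conjugate: all its incidences are betweenness relations. *)
Lemma harmonic_conjugate x y r z zb wb : independent3 r x y -> 2^-1 < z < 1 ->
  b (x + z *: (y - x)) = b x + zb *: (b y - b x) ->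
  b (x + (z / (2 * z - 1)) *: (y - x)) = b x + wb *: (b y - b x) ->
  zb + wb = 2 * zb * wb.
Proof.
move=> ixy /andP[z0 z1]; set Z := x + z *: _; set W := x + _ *: _ => bZ bW.
have NE (p q : V) (s t : R) :
    p - q = s *: (x - r) + t *: (y - r) -> s != 0 -> p != q.
  move=> pq; apply: contraNneq => E; move: pq; rewrite E subrr => /esym.
  by move=> /ixy[-> _].
have NE' (p q : V) (s t : R) :
    p - q = s *: (x - r) + t *: (y - r) -> t != 0 -> p != q.
  move=> pq; apply: contraNneq => E; move: pq; rewrite E subrr => /esym.
  by move=> /ixy[_ ->].
(* The segments [Z r], [f x] and [y e] meet in [O], and [f] lies on the segment [W e]. *)
pose e := 2^-1 *: r + (1 - 2^-1) *: x.
pose f := (1 - z) *: r + (1 - (1 - z)) *: y.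
pose k := (2 - z)^-1.
pose O := k *: Z + (1 - k) *: r.
have k01 : 0 < k < 1 by rewrite invr_gt0 invf_lt1; lra.
have k2 : k * (2 - z) = 1 by rewrite mulVf//; lra.
have Of : O = k *: f + (1 - k) *: x.
  by apply/rowP => j; rewrite !mxE /k; field; lra.
have Oe : O = (k * z) *: y + (1 - k * z) *: e.
  by apply/rowP => j; rewrite !mxE /k; field; lra.
have fW : f = (2 * z - 1) *: W + (1 - (2 * z - 1)) *: e.
  by apply/rowP => j; rewrite !mxE; field; lra.
have z21 : 0 < 2 * z - 1 < 1 by lra.
have kz : 0 < k * z < 1 by nra.
have rx : r != x.
  by apply: (NE _ _ (-1) 0); [apply/rowP => j; rewrite !mxE; ring|lra].
have ry : r != y.
  by apply: (NE' _ _ 0 (-1)); [apply/rowP => j; rewrite !mxE; ring|lra].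
have Zr : Z != r.
  by apply: (NE' _ _ (1 - z) z); [apply/rowP => j; rewrite !mxE; ring|lra].
have fx : f != x.
  by apply: (NE' _ _ (-1) z); [apply/rowP => j; rewrite !mxE; ring|lra].
have ye : y != e.
  by apply: (NE' _ _ (-2^-1) 1); [apply/rowP => j; rewrite !mxE; field|lra].
have We : W != e.
  apply: (NE' _ _ (2^-1 - z / (2 * z - 1)) (z / (2 * z - 1))).
    by apply/rowP => j; rewrite !mxE; field; lra.
  by rewrite mulf_neq0 ?invr_neq0; lra.
have half : 0 < (2^-1 : R) < 1 by lra.
have z10 : 0 < 1 - z < 1 by lra.
have [a a01 be] := b_between rx half.
have [d d01 bf] := b_between ry z10.
have [h /andP[h0 h1] bO1] := b_between Zr k01.
have [m m01 bO2] := b_between fx k01.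
have [n n01 bO3] := b_between ye kz.
have [t t01 bf2] := b_between We z21.
rewrite -/e in be; rewrite -/f in bf; rewrite -/O in bO1.
rewrite -Of in bO2; rewrite -Oe in bO3; rewrite -fW in bf2.
have ibxy := b_independent3 ixy.
have [e1 e2] : h * (1 - zb) - (m * 0 + (1 - m)) = 0 /\
    h * zb - m * (1 - d) = 0.
  apply: ibxy; rewrite -[RHS](subrr (b O)) {1}bO1 bO2 bZ bf.
  by apply/rowP => j; rewrite !mxE; ring.
have [e3 e4] : h * (1 - zb) - (1 - n) * (1 - a) = 0 /\ h * zb - n = 0.
  apply: ibxy; rewrite -[RHS](subrr (b O)) {1}bO1 bO3 bZ be.
  by apply/rowP => j; rewrite !mxE; ring.
have [e5 e6] : t * (1 - wb) + (1 - t) * (1 - a) = 0 /\ t * wb - (1 - d) = 0.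
  apply: ibxy; rewrite -[RHS](subrr (b f)) {1}bf2 bf bW be.
  by apply/rowP => j; rewrite !mxE; ring.
(* In the image triangle, [c1] is Ceva's relation for the cevians through [b O], and [c2] is
   Menelaus' relation for the line through [b e], [b f] and [b W]. *)
pose A := 1 - a; pose B := 1 - d.
have c1 : A * B * (2 * zb - 1) = A * zb - B * (1 - zb).
  apply: (mulfI (lt0r_neq0 h0)).
  have E1 : B * (1 - h * (1 - zb)) = h * zb.
    have -> : h * (1 - zb) = 1 - m by lra.
    have -> : h * zb = m * (1 - d) by lra.
    by rewrite /B; ring.
  have E2 : A * (1 - h * zb) = h * (1 - zb).
    have -> : h * zb = n by lra.
    have -> : h * (1 - zb) = (1 - n) * (1 - a) by lra.
    by rewrite /A; ring.
  transitivity (A * (B * (1 - h * (1 - zb))) - B * (A * (1 - h * zb))).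
    by ring.
  by rewrite E1 E2; ring.
have tA : t * (1 - A) = B - A by rewrite /A /B; lra.
have BA : 0 < B - A by rewrite -tA mulr_gt0 ?/A; lra.
have c2 : B * (1 - A) = wb * (B - A).
  rewrite -tA; have -> : B = t * wb by rewrite /B; lra.
  by ring.
apply: (mulfI (lt0r_neq0 BA)).
transitivity (zb * (B - A) + wb * (B - A)); first by ring.
transitivity (2 * zb * (wb * (B - A))); last by ring.
by rewrite -c2; lra.
Qed.

(** Among the parameters 0, 1 and [t], one lies between the other two; the betweenness relation
    there is solved for [b (x + t *: v)]. *)
Lemma line_coordinate x v : v != 0 -> exists g : R -> R,
  forall t, b (x + t *: v) = b x + g t *: (b (x + v) - b x).
Proof.
move=> v0.
have NE s t : s != t -> x + s *: v != x + t *: v.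
  apply: contra_neq => /addrI/eqP.
  by rewrite -subr_eq0 -scalerBl scaler_eq0 (negbTE v0) orbF subr_eq0 => /eqP.
have N s t k : s != t -> 0 < k < 1 -> exists2 h, 0 < h < 1 &
    b (x + (k * s + (1 - k) * t) *: v) =
    h *: b (x + s *: v) + (1 - h) *: b (x + t *: v).
  move=> /NE/b_between H /H[h h01 E]; exists h => //; rewrite -E; congr b.
  by apply/rowP => j; rewrite !mxE; ring.
have E0 : x + 0 *: v = x by rewrite scale0r addr0.
have E1 : x + 1 *: v = x + v by rewrite scale1r.
suff /choice[g gP] : forall t, exists k,
  b (x + t *: v) = b x + k *: (b (x + v) - b x) by exists g.
move=> t; have [t0|t0|<-] := ltgtP 0 t; last 2 first.
- have k01 : 0 < (1 - t)^-1 < 1 by rewrite invr_gt0 invf_lt1; lra.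
  have t1 : t != 1 by rewrite lt_eqF//; lra.
  have [h h01] := N _ _ _ t1 k01.
  have -> : (1 - t)^-1 * t + (1 - (1 - t)^-1) * 1 = 0.
    by field; rewrite ?gt_eqF//; lra.
  rewrite E0 E1 => /rowP E; exists ((h - 1) / h); apply/rowP => j.
  by have := E j; rewrite !mxE => ->; field; rewrite ?gt_eqF//; lra.
- by exists 0; rewrite E0 scale0r addr0.
have [t1|t1|->] := ltgtP t 1; last first.
- by exists 1; rewrite E1 scale1r subrKC.
- have k01 : 0 < t^-1 < 1 by rewrite invr_gt0 invf_lt1; lra.
  have tN0 : t != 0 by rewrite gt_eqF.
  have [h h01] := N _ _ _ tN0 k01.
  have -> : t^-1 * t + (1 - t^-1) * 0 = 1 by field.
  rewrite E0 E1 => /rowP E; exists h^-1; apply/rowP => j.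
  by have := E j; rewrite !mxE => ->; field; rewrite ?gt_eqF//; lra.
have k01 : 0 < t < 1 by rewrite t0.
have [h h01] := N 1 0 t (oner_neq0 _) k01.
rewrite mulr1 mulr0 addr0 E0 E1 => /rowP E; exists h; apply/rowP => j.
by have := E j; rewrite !mxE => ->; ring.
Qed.

Lemma line_coordinate_homo x v (g : R -> R) : v != 0 ->
  (forall t, b (x + t *: v) = b x + g t *: (b (x + v) - b x)) ->
  [/\ {homo g : s t / s < t}, harmonic_map g, g 0 = 0 & g 1 = 1].
Proof.
move=> v0 gP; set w := b (x + v) - b x in gP.
have w0 : w != 0.
  rewrite subr_eq0; apply: contra_neq v0 => /b_inj/eqP.
  by rewrite addrC -subr_eq0 addrK => /eqP.
have wI (s t : R) : b x + s *: w = b x + t *: w -> s = t.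
  move=> /addrI/eqP; rewrite -subr_eq0 -scalerBl scaler_eq0 (negbTE w0) orbF.
  by rewrite subr_eq0 => /eqP.
have g0 : g 0 = 0.
  by apply: wI; rewrite -gP !scale0r !addr0.
have g1 : g 1 = 1.
  by apply: wI; rewrite -gP !scale1r /w subrKC.
have gI s t : s != t -> g s != g t.
  apply: contra_neq => E.
  have : b (x + s *: v) = b (x + t *: v) by rewrite !gP E.
  move=> /b_inj/addrI/eqP.
  by rewrite -subr_eq0 -scalerBl scaler_eq0 (negbTE v0) orbF subr_eq0 => /eqP.
have gB r s t : r < s -> s < t -> 0 < (g s - g r) * (g t - g s).
  move=> rs st.
  have NE : x + t *: v != x + r *: v.
    apply: contraTneq (gI t r _) => [E|]; last by rewrite gt_eqF//; lra.
    by rewrite negbK; apply/eqP/wI; rewrite -!gP E.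
  have k01 : 0 < (s - r) / (t - r) < 1.
    by rewrite divr_gt0/= ?ltr_pdivrMr; lra.
  have [h h01] := b_between NE k01.
  have -> : (s - r) / (t - r) *: (x + t *: v) +
      (1 - (s - r) / (t - r)) *: (x + r *: v) = x + s *: v.
    by apply/rowP => j; rewrite !mxE; field; rewrite ?gt_eqF//; lra.
  rewrite !gP => E.
  have -> : g s = h * g t + (1 - h) * g r.
    by apply: wI; rewrite E; apply/rowP => j; rewrite !mxE; ring.
  have -> : (h * g t + (1 - h) * g r - g r) * (g t - (h * g t + (1 - h) * g r))
    = (h * (1 - h)) * (g t - g r) ^+ 2 by ring.
  case/andP: h01 => h0 h1; apply: mulr_gt0.
    by rewrite mulr_gt0// subr_gt0.
  rewrite exprn_even_gt0//= subr_eq0; apply: gI.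
  by rewrite gt_eqF// (lt_trans rs).
have gH : {homo g : s t / s < t}.
  move=> s t st.
  (* The outer parameters [A] and [B] lie beyond [s], [t], 0 and 1. Comparison with 0 and 1 gives
     [g A < 0] and [1 < g B], while a descent from [s] to [t] would give [g B < g A]. *)
  pose A := Num.min s 0 - 1; pose B := Num.max t 1 + 1.
  have m1 : Num.min s 0 <= s by rewrite ge_min lexx.
  have m2 : Num.min s 0 <= 0 by rewrite ge_min lexx orbT.
  have m3 : t <= Num.max t 1 by rewrite le_max lexx.
  have m4 : 1 <= Num.max t 1 by rewrite le_max lexx orbT.
  have As : A < s by rewrite /A ltrBlDr (le_lt_trans m1)// ltrDl.
  have A0 : A < 0 by rewrite /A ltrBlDr (le_lt_trans m2)// ltrDl.
  have tB : t < B by rewrite /B (le_lt_trans m3)// ltrDl.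
  have B1 : 1 < B by rewrite /B (le_lt_trans m4)// ltrDl.
  have := gB _ _ _ A0 ltr01; have := gB _ _ _ ltr01 B1.
  rewrite g0 g1 subr0 mul1r mulr1 => h1 h2.
  have := gB _ _ _ As st; have := gB _ _ _ st tB => h3 h4.
  rewrite ltNge; apply/negP; rewrite le_eqVlt => /predU1P[/esym/eqP|h5].
    by apply/negP/gI; rewrite lt_eqF.
  have : g B < g t by nra.
  have : g s < g A by nra.
  by lra.
split=> // X Y z XY z1.
have [e eP] := independent3_exists v0.
pose r := x + e; pose x1 := x + X *: v; pose y1 := x + Y *: v.
have YX : Y - X != 0 by rewrite subr_eq0 eq_sym.
have i3 : independent3 r x1 y1.
  move=> s t E; have [] := eP (s * X + t * Y) (- (s + t)).
    by rewrite -[RHS]E; apply/rowP => j; rewrite !mxE; ring.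
  move=> E1 /eqP; rewrite oppr_eq0 => /eqP E2.
  have t0 : t = 0.
    apply: (mulIf YX); rewrite mul0r.
    have -> : t * (Y - X) = (s * X + t * Y) - (s + t) * X by ring.
    by rewrite E1 E2; ring.
  by split=> //; lra.
pose D := g Y - g X.
have D0 : D != 0 by rewrite subr_eq0 gI// eq_sym.
have on t : b (x1 + t *: (y1 - x1)) =
    b x1 + ((g (X + t * (Y - X)) - g X) / D) *: (b y1 - b x1).
  have -> : x1 + t *: (y1 - x1) = x + (X + t * (Y - X)) *: v.
    by apply/rowP => j; rewrite !mxE; ring.
  rewrite /x1 /y1 !gP; apply/rowP => j; rewrite !mxE.
  by rewrite /D in D0 *; field.
have := harmonic_conjugate i3 z1 (on z) (on _).
set P := g _ - _; set Q := g _ - g X => /(congr1 ( *%R (D ^+ 2))).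
have -> : D ^+ 2 * (P / D + Q / D) = D * (P + Q) by field.
have -> : D ^+ 2 * (2 * (P / D) * (Q / D)) = 2 * P * Q by field.
by move=> <-; rewrite /P /Q /D; ring.
Qed.

(** On every line [b] is affine, by [midpoint_id]. Lines through 0 give homogeneity; additivity
    comes from computing the midpoint of [x] and [y] on two lines. *)
Lemma between_affine : exists A : 'M[R]_c,
  A \in unitmx /\ forall x, b x = x *m A + b 0.
Proof.
have line x v t : b (x + t *: v) = b x + t *: (b (x + v) - b x).
  have [->|v0] := eqVneq v 0.
    by rewrite scaler0 addr0 subrr scaler0 addr0.
  have [g gP] := line_coordinate x v0.
  have [gI gH g0 g1] := line_coordinate_homo v0 gP.
  by rewrite gP (midpoint_id gI (harmonic_map_midpoint gI gH)).
pose f x := b x - b 0.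
have fZ t x : f (t *: x) = t *: f x.
  by have := line 0 x t; rewrite !add0r /f => ->; rewrite addrC addKr.
have fD x y : f (x + y) = f x + f y.
  have E1 := line x (y - x) 2^-1; rewrite subrKC in E1.
  have E2 := line 0 (x + y) 2^-1; rewrite !add0r in E2.
  have E3 : x + 2^-1 *: (y - x) = 2^-1 *: (x + y).
    by apply/rowP => j; rewrite !mxE; field.
  rewrite -E3 E1 in E2; rewrite /f; apply/rowP => j.
  by move/rowP/(_ j): E2; rewrite !mxE; lra.
pose A : 'M[R]_c := \matrix_i f (delta_mx 0 i).
have fA x : f x = x *m A.
  rewrite {1}(row_sum_delta x) mulmx_sum_row.
  have f0 : f 0 = 0 by rewrite /f subrr.
  rewrite (big_morph f fD f0); apply: eq_bigr => i _.
  by rewrite fZ rowK.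
exists A; split; last by move=> x; rewrite -fA /f subrK.
rewrite -row_free_unit -kermx_eq0; apply/rowV0P => v /sub_kermxP vA.
have : b v = b 0 by apply/eqP; rewrite -subr_eq0 -/(f v) fA vA.
exact: b_inj.
Qed.

End Betweenness.

(** * Affine minorants *)

Section Separation.
Context (R : realType) (c : nat).
Local Notation V := 'rV[R]_c.
Implicit Types (C D : set V) (x y : V).

Lemma continuous_sumr (T : topologicalType) (I : finType) (F : I -> T -> R) :
  (forall i, continuous (F i)) -> continuous (fun a => \sum_i F i a).
Proof.
move=> cF a; rewrite /continuous_at.
elim: (index_enum I) => [|i r IH].
  by rewrite big_nil; under eq_fun do rewrite big_nil; exact: cvg_cst.
rewrite big_cons; under eq_fun do rewrite big_cons.
by apply: cvgD => //; exact: cF.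
Qed.

Lemma coord_le_norm x i : `|x 0 i| <= `|x|.
Proof.
rewrite [leRHS]/Num.norm /= mx_normrE; apply/bigmax_geP; right => /=.
by exists (0, i).
Qed.

Lemma compact_sub_poly C : (0 < c)%N -> compact C -> exists s, C `<=` poly s.
Proof.
move=> c0 /compact_bounded[N0 [_ N0C]]; pose N := Num.max N0 0 + 1.
have N0N : N0 < N by rewrite /N ltr_pwDr// le_max lexx.
have N_gt0 : 0 < N by rewrite /N ltr_wpDl// le_max lexx orbT.
(* A point with coordinates at most [N] is the average of the [c] axis points [c * x_i], whence the
   radius [c * N] of the cross-polytope. *)
pose e (i : 'I_c) : V := (c%:R * N) *: delta_mx 0 i.
exists ([seq e i | i <- enum 'I_c] ++ [seq - e i | i <- enum 'I_c]) => x Cx.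
have xN i : `|x 0 i| <= N.
  exact: le_trans (coord_le_norm x i) (N0C _ N0N _ Cx).
set s := _ ++ _; have [_ cs] := compact_convex_poly s.
have cR0 : c%:R != 0 :> R by rewrite pnatr_eq0 -lt0n.
have -> : x = \sum_(i < c) c%:R^-1 *: ((c%:R * x 0 i) *: delta_mx 0 i).
  rewrite {1}(row_sum_delta x); apply: eq_bigr => i _.
  by rewrite scalerA mulKf.
apply: convex_comb => //.
  by rewrite sumr_const card_ord -[LHS]mulr_natr mulVf.
move=> i _.
have /convex_setP cs' := cs.
have -> : (c%:R * x 0 i) *: delta_mx 0 i =
    ((x 0 i + N) / (2 * N)) *: e i + (1 - (x 0 i + N) / (2 * N)) *: (- e i).
  by apply/rowP => j; rewrite !mxE; field; rewrite gt_eqF.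
have := xN i; rewrite ler_norml => /andP[h1 h2].
apply: cs'.
- by apply/andP; split; [rewrite divr_ge0//; lra|rewrite ler_pdivrMr; lra].
- by apply: poly_mem; rewrite mem_cat; apply/orP; left;
    apply/mapP; exists i; rewrite ?mem_enum.
- by apply: poly_mem; rewrite mem_cat; apply/orP; right;
    apply/mapP; exists i; rewrite ?mem_enum.
Qed.

(* A closed half-space separates the point [(y, t)] from the compact truncated
   epigraph of [f]: project the point orthogonally onto it. When the bounding
   hyperplane is not the graph of a function, the resulting affine function
   separates [y] from the domain of [f] and is scaled up. *)
Lemma affine_minorant (f : V -> \bar R) (k t : R) y :
  (forall x, 0 <= f x <= k%:E \/ f x = +oo)%E ->
  lower_semicontinuous f -> convex_efun f ->
  compact (f @^-1` [set z | 0 <= z <= k%:E]%E) -> (exists x, f x = 0%E) ->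
  (t%:E < f y)%E -> t <= k ->
  exists l : V -> R, [/\ continuous l,
    forall u v r, l (r *: u + (1 - r) *: v) = r * l u + (1 - r) * l v,
    forall x, ((l x)%:E < f x)%E & t < l y].
Proof.
move=> f01 fsc fcvx kf [z fz] tfy tk.
have f_ge0 x : (0 <= f x)%E by case: (f01 x) => [/andP[]//|->].
have k0 : 0 <= k.
  by have := f01 z; rewrite fz => -[/andP[_]|//]; rewrite lee_fin.
pose S : set (V * R^o) := [set p | (f p.1 <= p.2%:E)%E /\ p.2 <= k].
have S_compact : compact S.
  have -> : S = ((f @^-1` [set z | 0 <= z <= k%:E]%E) `*` `[0, k]%classic)
      `&` [set p | (f p.1 <= p.2%:E)%E].
    apply/seteqP; split=> [[x s] [/= fxs sk]|[x s] [[/= _]]].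
      have s0 : 0 <= s by rewrite -lee_fin (le_trans (f_ge0 x)).
      split=> //; split=> /=; last by rewrite in_itv/= s0.
      by rewrite f_ge0 (le_trans fxs) ?lee_fin.
    by rewrite in_itv/= => /andP[_ sk] fxs.
  apply: compact_closedI.
    exact: (compact_setX kf (@segment_compact R 0 k)).
  rewrite -openC openE => -[x s] /= /negP; rewrite -ltNge => sfx.
  have [a sa afx] : exists2 a, s < a & (a%:E < f x)%E.
    case: (f x) sfx => [r|_|//]; last by exists (s + 1); rewrite ?ltry// ltrDl.
    rewrite lte_fin => sr; exists ((s + r) / 2); last rewrite lte_fin; lra.
  have [U xU Uf] := fsc _ _ afx.
  exists (U, [set s' | s' < a]); first split=> //=.
    by apply: open_nbhs_nbhs; split; [exact: open_lt|].
  move=> [x' s'] [/= /Uf ax' s'a]; apply/negP; rewrite -ltNge.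
  by rewrite (lt_trans _ ax')// lte_fin.
have Sz : S (z, k) by split=> //=; rewrite fz lee_fin.
(* The squared Euclidean distance to [(y, t)], minimised on [S] at [(x0, s0)]. *)
pose F (p : V * R^o) : R := \sum_i (p.1 0 i - y 0 i) ^+ 2 + (p.2 - t) ^+ 2.
have coord (i : 'I_c) : continuous (fun x : V => x 0 i).
  exact: coord_continuous.
have F_cont : continuous F.
  move=> p; apply: cvgD; last first.
    by apply: cvgM; apply: cvgB; solve [exact: cvg_snd|exact: cvg_cst].
  apply: continuous_sumr => i {}p; rewrite /continuous_at.
  have cp : (fun q : V * R^o => q.1 0 i) @ p --> p.1 0 i.
    apply: (@cvg_comp _ _ _ fst (fun x : V => x 0 i)); first exact: cvg_fst.
    exact: coord.
  by apply: cvgM; apply: cvgB => //; exact: cvg_cst.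
have [[x0 s0] /set_mem[Sf Sk] Smin] : exists2 p, p \in S &
    forall q, q \in S -> F p <= F q.
  apply: compact_EVT_min => //; first by exists (z, k).
  exact: continuous_subspaceT.
pose w i := y 0 i - x0 0 i; pose tau := t - s0.
pose dot x := \sum_i (x 0 i - x0 0 i) * w i.
pose N := dot y + tau ^+ 2.
(* The variational inequality of the projection: if it failed, moving from [(x0, s0)] towards
   [(x, s)] by the small fraction [e] would decrease [F]. *)
have var x s : S (x, s) -> dot x + (s - s0) * tau <= 0.
  move=> [/= fxs sk]; set A := dot x + _; rewrite leNgt; apply/negP => A0.
  pose B := \sum_i (x 0 i - x0 0 i) ^+ 2 + (s - s0) ^+ 2.
  have B0 : 0 <= B.
    by rewrite addr_ge0 ?sqr_ge0// sumr_ge0// => i _; exact: sqr_ge0.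
  pose e := A / (A + B + 1).
  have AB : 0 < A + B + 1 by lra.
  have e0 : 0 < e by rewrite divr_gt0.
  have e1 : e < 1 by rewrite ltr_pdivrMr//; lra.
  have Sq : S (e *: x + (1 - e) *: x0, e * s + (1 - e) * s0).
    split=> /=; last by rewrite /= in Sk; nra.
    have e01 : 0 <= e <= 1 by rewrite !ltW.
    apply: (le_trans (fcvx x x0 e e01)).
    rewrite [leRHS](_ : _ = e%:E * s%:E + (1 - e)%:E * s0%:E)%E//.
    apply: leeD; apply: lee_wpmul2l => //.
      by rewrite lee_fin ltW.
    by rewrite lee_fin subr_ge0 ltW.
  have := Smin _ (mem_set Sq).
  have -> : F (e *: x + (1 - e) *: x0, e * s + (1 - e) * s0) =
      F (x0, s0) - 2 * e * A + e ^+ 2 * B.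
    have sumE : \sum_i ((e *: x + (1 - e) *: x0) 0 i - y 0 i) ^+ 2 =
        \sum_i (x0 0 i - y 0 i) ^+ 2 - 2 * e * dot x
        + e ^+ 2 * \sum_i (x 0 i - x0 0 i) ^+ 2.
      rewrite /dot !mulr_sumr -sumrN -!big_split/=; apply: eq_bigr => i _.
      by rewrite !mxE /w; ring.
    by rewrite /F sumE /A /B /tau /=; ring.
  have eAB : e * (A + B + 1) = A by rewrite /e divfK// gt_eqF.
  by nra.
have N0 : 0 < N.
  have w2 i : 0 <= (y 0 i - x0 0 i) * w i by rewrite -expr2 sqr_ge0.
  have dy : 0 <= dot y by exact: sumr_ge0.
  rewrite lt_neqAle eq_sym addr_ge0 ?sqr_ge0// andbT paddr_eq0 ?sqr_ge0//.
  apply/negP => /andP[].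
  rewrite psumr_eq0// sqrf_eq0 subr_eq0 => /allP dy0 /eqP ts.
  have yx : y = x0.
    apply/rowP => i; have := dy0 i; rewrite mem_index_enum -expr2 sqrf_eq0.
    by move=> /(_ isT); rewrite subr_eq0 => /eqP.
  by move: tfy; rewrite ltNge yx ts Sf.
have dot_cont : continuous dot.
  suff dw i : continuous (fun x : V => (x 0 i - x0 0 i) * w i).
    exact: (continuous_sumr dw).
  move=> x; have ci : (fun x : V => x 0 i) @ x --> x 0 i by exact: coord.
  exact: (cvgM (cvgB ci (cvg_cst _)) (cvg_cst _)).
have dot_affine u v r :
    dot (r *: u + (1 - r) *: v) = r * dot u + (1 - r) * dot v.
  rewrite /dot !mulr_sumr -big_split/=; apply: eq_bigr => i _.
  by rewrite !mxE; ring.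
have [tau0|tau0] := ltP tau 0.
  (* The hyperplane halfway between the projection and [(y, t)], solved for its last coordinate. *)
  pose l x := s0 + (N / 2 - dot x) / tau.
  exists l; split.
  - move=> x; have cd : dot @ x --> dot x by exact: dot_cont.
    exact: (cvgD (cvg_cst _) (cvgM (cvgB (cvg_cst _) cd) (cvg_cst _))).
  - by move=> u v r; rewrite /l dot_affine; field; rewrite lt_eqF.
  - move=> x; case: (f01 x) => [/andP[fx0 fxk]|->]; last by rewrite ltry.
    have fxE : f x = (fine (f x))%:E.
      by rewrite fineK// ge0_fin_numE// (le_lt_trans fxk)// ltry.
    rewrite fxE lte_fin /l -ltrBrDl ltr_ndivrMr//.
    have : S (x, fine (f x)).
      by split=> /=; [rewrite -fxE|rewrite -lee_fin -fxE].
    by move/var; lra.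
  - rewrite /l -ltrBlDl -/tau ltr_ndivlMr//.
    have : N = dot y + tau * tau by rewrite /N expr2.
    by lra.
(* Here [l] is negative on the domain of [f], where [f >= 0], and [K] scales its value at [y] to at
   least [|t| + 1]. *)
pose K := 2 * (`|t| + 1) / N.
have K0 : 0 < K by rewrite divr_gt0// mulr_gt0// ltr_wpDl.
pose l x := K * (dot x + (k - s0) * tau - N / 2).
exists l; split.
- move=> x; have cd : dot @ x --> dot x by exact: dot_cont.
  exact: (cvgM (cvg_cst _) (cvgB (cvgD cd (cvg_cst _)) (cvg_cst _))).
- by move=> u v r; rewrite /l dot_affine; ring.
- move=> x; case: (f01 x) => [/andP[fx0 fxk]|->]; last by rewrite ltry.
  apply: lt_le_trans fx0; rewrite lte_fin pmulr_rlt0//.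
  have /var : S (x, k) by split=> /=.
  by lra.
- have : (t - s0) * tau <= (k - s0) * tau by rewrite ler_wpM2r//; lra.
  have NE : N = dot y + (t - s0) * tau by rewrite /N /tau; ring.
  move=> le1; have : N / 2 <= dot y + (k - s0) * tau - N / 2 by lra.
  rewrite -(ler_pM2l K0) -/(l y); apply: lt_le_trans.
  have -> : K * (N / 2) = `|t| + 1 by rewrite /K; field; rewrite gt_eqF.
  by rewrite (le_lt_trans (ler_norm t))// ltrDl.
Qed.

End Separation.

(** * The homomorphism *)

Section ConvexFunctions.
Context (R : realType) (c : nat).
Local Notation V := 'rV[R]_c.
Implicit Types (f g h : V -> \bar R) (x y : V).
Local Open Scope ereal_scope.

Definition affine_fun (l : V -> R) : Prop := forall x y t,
  (l (t *: x + (1 - t) *: y) = t * l x + (1 - t) * l y)%R.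

Lemma Cvx_0y_max_affine (l : V -> R) : continuous l -> affine_fun l ->
  (exists x, l x <= 0)%R -> Cvx_0y (fun x => (Num.max (l x) 0%R)%:E).
Proof.
move=> cl al [z lz]; left; split; last first.
  split; first by move=> x; rewrite lee_fin le_max lexx orbT.
  by exists z; congr EFin; apply/max_idPr.
left; split; first by move=> x; exact: ltNyr.
split=> [x a|x y t /andP[t0 t1]].
  rewrite lte_fin lt_max => /orP[alx|a0].
    exists [set y | a < l y]%R; first exact: (cvgr_gt (l x) (cl x) a alx).
    by move=> y /= aly; rewrite lte_fin lt_max aly.
  by exists setT; [exact: filterT|move=> y _; rewrite lte_fin lt_max a0 orbT].
rewrite -!EFinM -EFinD lee_fin al ge_max; apply/andP; split.
  by apply: lerD; apply: ler_wpM2l; rewrite ?le_max ?lexx// subr_ge0.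
by rewrite addr_ge0// mulr_ge0 ?subr_ge0// le_max lexx orbT.
Qed.

(** A common zero is what puts the pointwise maximum into [Cvx_0y]. *)
Lemma cvx_meet_max f g z : Cvx_0y f -> Cvx_0y g -> f z = 0 -> g z = 0 ->
  forall x, cvx_meet f g x = maxe (f x) (g x).
Proof.
move=> Cf Cg fz gz x; have [[Cm mU] mL] := cvx_meetP Cf Cg.
apply/eqP; rewrite eq_le ge_max; apply/andP; split; last first.
  have /lefP -> := mU f (or_introl erefl).
  by have /lefP -> := mU g (or_intror erefl).
pose h x := ereal_sup [set k x | k in [set f; g]].
have hub k y : [set f; g] k -> k y <= h y.
  by move=> fgk; apply: ereal_sup_ubound; exists k.
have hE y : h y = maxe (f y) (g y).
  apply/eqP; rewrite eq_le ge_max !hub; [|by right|by left].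
  rewrite /= andbT; apply: ge_ereal_sup => _ [k [->|->] <-];
    by rewrite le_max lexx ?orbT.
have Ch : Cvx_0y h.
  apply: (@Cvx_0y_sup _ _ [set f; g]) => //; first by move=> k [->|->].
    by exists f; left.
  by exists z; rewrite hE fz gz maxxx.
have /lefP/(_ x) : (cvx_meet f g <= h)%O; last by rewrite hE.
by apply: mL; split=> // k fgk; apply/lefP => y; exact: hub.
Qed.

Lemma cvx_join_ge f g h : Cvx_0y f -> Cvx_0y g -> Cvx_0y h ->
  (forall x, h x <= f x) -> (forall x, h x <= g x) ->
  forall x, h x <= cvx_join f g x.
Proof.
move=> Cf Cg Ch hf hg; apply/lefP; have [_ +] := cvx_joinP Cf Cg; apply.
by split=> // k [->|->]; apply/lefP.
Qed.

End ConvexFunctions.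

Section Homomorphism.
Context (R : realType) (kappa : R) (c : nat).
Local Notation V := 'rV[R]_c.
Implicit Types (C D : set V) (p q x y z : V) (h : V -> \bar R).
Context (H : set V -> V -> \bar R).
Hypothesis c_gt1 : (1 < c)%N.
Hypothesis HC : forall C, compact_convex C -> Cvx_0k kappa (H C).
Hypothesis H_meet : forall C D, compact_convex C -> compact_convex D ->
  H (C `&` D) = cvx_meet (H C) (H D).
Hypothesis H_join : forall C D, compact_convex C -> compact_convex D ->
  H (conv_hull (C `|` D)) = cvx_join (H C) (H D).
Local Open Scope ereal_scope.
Local Notation cc0 := (@compact_convex0 R c).
Local Notation cc1 := (@compact_convex1 R c).

Let HC0 C : compact_convex C -> Cvx_0y (H C).
Proof. by move=> /HC[_ []]. Qed.

Let H_ge0 C x : compact_convex C -> 0 <= H C x.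
Proof. by move=> /HC0; exact: Cvx_0y_ge0. Qed.

Lemma H_sub C D x : compact_convex C -> compact_convex D -> C `<=` D ->
  H D x <= H C x.
Proof.
move=> cC cD /setIidPl CD; rewrite -CD H_meet//.
have [[_ mU] _] := cvx_meetP (HC0 cC) (HC0 cD).
by have /lefP := mU (H D) (or_intror erefl); exact.
Qed.

Lemma H_setI C D z x : compact_convex C -> compact_convex D ->
  H C z = 0 -> H D z = 0 -> H (C `&` D) x = maxe (H C x) (H D x).
Proof.
move=> cC cD Cz Dz; rewrite H_meet//.
by apply: cvx_meet_max Cz Dz x; exact: HC0.
Qed.

Lemma H_zero C : compact_convex C -> (exists z, H C z = 0) \/ H C = cst +oo.
Proof. by move=> /HC0[[_ [_ ?]]|->]; [left|right]. Qed.

(** The points [q] with [h <= H [set q]] form a convex set, because the image of a segment is the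
    greatest element below the images of its ends. *)
Lemma H_sgm_ge h q r y : Cvx_0y h -> sgm q r y ->
  (forall x, h x <= H [set q] x) -> (forall x, h x <= H [set r] x) ->
  forall x, h x <= H [set y] x.
Proof.
move=> Ch qry hq hr x; apply: (@le_trans _ _ (H (sgm q r) x)).
  rewrite /sgm H_join; try exact: cc1.
  by apply: cvx_join_ge => //; apply: HC0; exact: cc1.
apply: H_sub; [exact: cc1|exact: compact_convex_sgm|by move=> _ ->].
Qed.

(** A compact set lies in a polytope, an iterated join of points. *)
Lemma H_ge h : Cvx_0y h -> (forall q x, h x <= H [set q] x) ->
  forall C x, compact_convex C -> h x <= H C x.
Proof.
move=> Ch hq C x cC.
have [s Cs] := compact_sub_poly (ltnW c_gt1) cC.1.
have cs := compact_convex_poly s.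
apply: le_trans (H_sub x cC cs Cs); move: x => {Cs cs}.
elim: s => [|p s IH] x /=.
  apply: (le_trans (hq 0%R x)); apply: H_sub => //; [exact: cc0|exact: cc1].
rewrite H_join; [|exact: compact_convex_poly|exact: cc1].
apply: cvx_join_ge => //; apply: HC0; last exact: cc1.
exact: compact_convex_poly.
Qed.

Lemma H_cst : (forall p, H [set p] = H set0) ->
  forall C, compact_convex C -> H C = H set0.
Proof.
move=> Hp C cC; apply/funext => x; apply/eqP; rewrite eq_le.
rewrite H_sub ?(H_ge (h := H set0))//; [exact: HC0 cc0| |exact: cc0].
by move=> q y; rewrite Hp.
Qed.

(** The assumed common zero makes the meet a pointwise maximum, whose sublevel set is an
    intersection. *)
Lemma H_le_meet_map (l : V -> R) : affine_fun l ->
  (forall C D x, compact_convex C -> compact_convex D ->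
     H C x <= (l x)%:E -> H D x <= (l x)%:E ->
     exists z, H C z = 0 /\ H D z = 0) ->
  (forall x, (l x)%:E < H set0 x) ->
  meet_map (fun C => [set x | H C x <= (l x)%:E]).
Proof.
move=> al zCD l0; split.
- move=> C cC; apply/convex_setP => x y t t01 /= Cx Cy.
  have [_ cH] := Cvx_0yP (HC0 cC).
  apply: (le_trans (cH x y t t01)); rewrite al
    [leRHS](_ : _ = t%:E * (l x)%:E + (1 - t)%:E * (l y)%:E)//.
  by case/andP: t01 => t0 t1; apply: leeD; apply: lee_wpmul2l => //;
    rewrite lee_fin ?subr_ge0.
- move=> C D cC cD; apply/seteqP; split=> [x /= CDx|x /= [Cx Dx]].
    have cCD := compact_convexI cC cD.
    by split; apply: le_trans CDx; apply: H_sub => // y [].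
  have [z [Cz Dz]] := zCD _ _ _ cC cD Cx Dx.
  by rewrite (H_setI x cC cD Cz Dz) ge_max Cx Dx.
- by apply/seteqP; split=> // x /=; rewrite leNgt l0.
Qed.

(* Let [l] be an affine function below [H set0] with [H [set p] y < l y] for
   some [y].  By [H_sgm_ge] the set of those [q] with [H [set q] >= l] is
   midpoint convex and misses [p], so it misses one of [p + m], [p - m] for each
   point [m] of the moment curve.  For such a [q] the sublevel set
   [H [set q] <= l] has two points, because [H [set q]] vanishes where
   [H set0] does, contradicting [fat_countable]. *)
Lemma H_set1_set0 k0 : H set0 k0 = 0 -> forall p, H [set p] = H set0.
Proof.
move=> H0k p; apply/funext => y; apply/eqP; rewrite eq_le.
rewrite H_sub//=; [|exact: cc0|exact: cc1].
rewrite leNgt; apply/negP => Hpy.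
have Hk C : compact_convex C -> H C k0 = 0.
  move=> cC; apply/eqP; rewrite eq_le H_ge0// andbT.
  by apply: (le_trans (H_sub k0 cc0 cC (@sub0set _ _))); rewrite H0k.
have [H01 [_ kH]] := HC cc0.
have [fsc fcvx] := Cvx_0yP (HC0 cc0).
have [Hp01 _] := HC (cc1 p).
have [t tE tk] : exists2 t : R, H [set p] y = t%:E & (t <= kappa)%R.
  case: (Hp01 y) => [/andP[a0 ak]|E]; last by rewrite E ltNge leey in Hpy.
  have fE : (fine (H [set p] y))%:E = H [set p] y.
    by rewrite fineK// ge0_fin_numE// (le_lt_trans ak)// ltry.
  by exists (fine (H [set p] y)); rewrite -?lee_fin fE.
rewrite tE in Hpy.
have [l [cl al lH lt]] :=
  affine_minorant H01 fsc fcvx kH (ex_intro _ k0 H0k) Hpy tk.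
have lk : (l k0 < 0)%R by have := lH k0; rewrite H0k lte_fin.
have Ch : Cvx_0y (fun x => (Num.max (l x) 0%R)%:E).
  by apply: Cvx_0y_max_affine => //; exists k0; exact: ltW.
have mM : meet_map (fun C => [set x | H C x <= (l x)%:E]).
  apply: H_le_meet_map => // C D x cC cD _ _.
  by exists k0; rewrite !Hk.
pose T := [set q | forall x, (Num.max (l x) 0%R)%:E <= H [set q] x].
have fat q : ~ T q -> exists y1 y2,
    [/\ H [set q] y1 <= (l y1)%:E, H [set q] y2 <= (l y2)%:E & y1 <> y2].
  move=> /existsNP[z /negP].
  rewrite -ltNge EFin_max lt_max => /orP[lz|]; last first.
    by rewrite ltNge H_ge0//; exact: cc1.
  have zk : z <> k0.
    move=> E; move: lz; rewrite E Hk ?lte_fin; last exact: cc1.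
    by move=> /(lt_trans lk); rewrite ltxx.
  have [_ cH] := Cvx_0yP (HC0 (cc1 q)).
  have [a aE] : exists a : R, H [set q] z = a%:E.
    exists (fine (H [set q] z)).
    rewrite fineK// ge0_fin_numE; last exact: H_ge0 (cc1 q).
    by rewrite (lt_trans lz) ?ltry.
  rewrite aE lte_fin in lz.
  (* The second point lies where the chord from [(k0, 0)] to [(z, a)] crosses the graph of [l]. *)
  pose e := ((l z - a) / ((l z - a) - l k0))%R.
  have d0 : (0 < (l z - a) - l k0)%R by lra.
  have e01 : (0 < e < 1)%R by rewrite divr_gt0//= ?ltr_pdivrMr//; lra.
  exists z, (e *: k0 + (1 - e) *: z)%R; split.
  - by rewrite aE lee_fin ltW.
  - apply: (le_trans (cH _ _ e _)); first by case/andP: e01 => *; rewrite !ltW.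
    rewrite Hk; last exact: cc1.
    rewrite aE mule0 add0e -EFinM lee_fin al.
    have : (e * ((l z - a) - l k0) = l z - a)%R by rewrite divfK// gt_eqF.
    by lra.
  - move=> /rowP E; apply: zk; apply/rowP => j; have := E j; rewrite !mxE => Ej.
    have e0 : e != 0%R by rewrite gt_eqF//; case/andP: e01.
    by apply: (mulfI e0); lra.
have pT : ~ T p.
  move=> /(_ y); rewrite tE lee_fin ge_max => /andP[lyt _].
  by move: lt; rewrite ltNge lyt.
have /choice[sg sgP] : forall t : R, exists e : bool,
    ~ T (p + (-1) ^+ e *: moment c t)%R.
  move=> s; apply: contra_notP pT => /forallNP TT.
  have T1 := contrapT (TT true); have T2 := contrapT (TT false).
  apply: (H_sgm_ge Ch _ T1 T2).
  have := @sgm_mid R c (p + (-1) ^+ true *: moment c s)%R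
    (p + (-1) ^+ false *: moment c s)%R.
  rewrite [X in sgm _ _ X](_ : _ = p)//.
  by apply/rowP => j; rewrite !mxE /= expr0 expr1; field.
have := @fat_countable R c _ mM p setT sg (fun s _ => fat _ (sgP s)).
move=> ct; apply: (@uncountable_itvoo R 0 1 ltr01).
exact: (sub_countable (subset_card_le (@subsetT _ _))) ct.
Qed.

(** * The case where the empty set is sent to [+oo] *)

Section Proper.
Hypothesis H_set0 : H set0 = cst +oo.
Context (p0 z0 : V).
Hypothesis Hp0 : H [set p0] z0 = 0.

(** If [H [set q]] were [+oo], the reflection [p'] of [q] in [p0] would satisfy [H [set p'] <= H
    [set p0]]. Both would vanish at [z0], although their meet is [H set0]. *)
Lemma H_set1_zero q : exists z, H [set q] z = 0.
Proof.
case: (H_zero (cc1 q)) => // Hq; exfalso.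
pose p' := (2 *: p0 - q)%R.
have Cp' := HC0 (cc1 p').
have Hp'p : forall x, H [set p'] x <= H [set p0] x.
  apply: (@H_sgm_ge _ p' q p0 Cp') => //; last by move=> x; rewrite Hq leey.
  have := @sgm_mid R c p' q; rewrite [X in sgm _ _ X](_ : _ = p0)//.
  by apply/rowP => j; rewrite !mxE; field.
have Hp'0 : H [set p'] z0 = 0.
  apply/eqP; rewrite eq_le H_ge0 ?andbT; last exact: cc1.
  by apply: le_trans (Hp'p z0) _; rewrite Hp0.
have := H_setI z0 (cc1 p') (cc1 p0) Hp'0 Hp0.
rewrite Hp'0 Hp0 maxxx (_ : [set p'] `&` [set p0] = set0) ?H_set0//.
apply/seteqP; split=> // x [/= xp' xp0]; move: Hp0; rewrite (_ : p0 = q) ?Hq//.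
move: xp'; rewrite xp0 => /rowP E; apply/rowP => j.
by have := E j; rewrite !mxE; lra.
Qed.

Let Z C : set V := [set x | H C x <= 0].

Let ZP C x : compact_convex C -> Z C x <-> H C x = 0.
Proof.
move=> cC; split=> [Zx|E]; last by rewrite /Z/= E.
by apply/eqP; rewrite eq_le H_ge0// andbT.
Qed.

Lemma zero_set_meet_map : meet_map Z.
Proof.
apply: (@H_le_meet_map (fun=> 0%R)) => [x y t|C D x cC cD Cx Dx|x].
- by rewrite !mulr0 addr0.
- by exists x; split; apply/ZP.
- by rewrite H_set0 ltry.
Qed.

Lemma H_set1_affine : exists (b : V -> V) (A : 'M[R]_c),
  [/\ A \in unitmx, forall x, b x = (x *m A + b 0)%R &
      forall q, H [set q] (b q) = 0].
Proof.
have hM := zero_set_meet_map.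
have Z0 q : Z [set q] !=set0.
  by have [z Hz] := H_set1_zero q; exists z; apply/(ZP z (cc1 q)).
have /choice[b Zb] := Z0.
have Z1 q y : Z [set q] y -> y = b q.
  by move=> Zy; exact: (meet_map_singleton hM Z0 c_gt1 Zy (Zb q)).
have [] := @between_affine R c b c_gt1.
- by move=> p q E; apply: (meet_map_inj hM (y := b p)) => //; rewrite E.
- move=> p q t pq t01.
  have [s s01 Zs] := meet_map_between hM Z0 pq t01 (Zb p) (Zb q).
  by exists s => //; rewrite (Z1 _ _ Zs).
- by move=> p q r; exact: (meet_map_independent3 hM (Zb p) (Zb q) (Zb r)).
by move=> A [Au bA]; exists b, A; split=> // q; apply/(ZP _ (cc1 q)).
Qed.

(** * Infinite values outside the image of a set *)

Section Finite.
Context (b : V -> V) (A : 'M[R]_c).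
Hypotheses (A_unit : A \in unitmx) (bA : forall x, b x = (x *m A + b 0)%R).
Hypothesis Hb : forall q, H [set q] (b q) = 0.

Let Hb_mem C q : compact_convex C -> C q -> H C (b q) = 0.
Proof.
move=> cC Cq; apply/eqP; rewrite eq_le H_ge0// andbT.
apply: (@le_trans _ _ (H [set q] (b q))); last by rewrite Hb.
by apply: H_sub => //; [exact: cc1|move=> _ ->].
Qed.

Let fin C q := compact_convex C /\ H C (b q) != +oo.

Let fin_sub C D q : compact_convex D -> C `<=` D -> fin C q -> fin D q.
Proof.
move=> cD CD [cC Cq]; split=> //; rewrite -ltey.
by apply: (le_lt_trans (H_sub (b q) cC cD CD)); rewrite ltey.
Qed.

Let fin_mem C q : compact_convex C -> C q -> fin C q.
Proof. by move=> cC Cq; split=> //; rewrite Hb_mem. Qed.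

Let fin_setI C D p q : C p -> D p -> fin C q -> fin D q -> fin (C `&` D) q.
Proof.
move=> Cp Dp [cC Cq] [cD Dq]; split; first exact: compact_convexI.
rewrite (H_setI _ cC cD (Hb_mem cC Cp) (Hb_mem cD Dp)).
by rewrite /maxe; case: ifP.
Qed.

(** Cutting [C] with a segment from [p] in [C] to [q] keeps finiteness at [b q]. The hull of this
    piece with a point [x] off the line meets the segment from [q] to [x] in [x] alone. *)
Let fin_neq_mem C q : fin C q -> ~ C q -> exists2 x, x != q & fin [set x] q.
Proof.
move=> [cC Cq] nCq.
have [p Cp] : C !=set0.
  by apply/set0P; apply: contra_neq Cq => ->; rewrite H_set0.
have cpq := @compact_convex_sgm R c p q.
have fS : fin (C `&` sgm p q) q.
  apply: (@fin_setI _ _ p) => //; first exact: sgml.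
  by apply: fin_mem => //; exact: sgmr.
set S := C `&` sgm p q in fS; have [cS _] := fS.
have pq : (p - q != 0)%R.
  by rewrite subr_eq0; apply: contra_notN nCq => /eqP <-.
have [e eP] := independent3_exists c_gt1 pq.
pose x := (q + e)%R.
have xq : x != q.
  rewrite /x -subr_eq0 addrC addKr; apply/eqP => e0.
  have := eP 0%R 1%R; rewrite e0 scale0r scaler0 addr0 => /(_ erefl)[_ /eqP].
  by rewrite oner_eq0.
exists x => //.
have cE := compact_convex_hullU cS (cc1 x).
have cqx := @compact_convex_sgm R c q x.
have -> : [set x] = conv_hull (S `|` [set x]) `&` sgm q x.
  apply/seteqP; split=> [_ ->|y [Ey /sgmP[r r01 yE]]].
    by split; [apply: sub_conv_hull; right|exact: sgmr].
  have S0 : S !=set0 by exists p; split => //; exact: sgml.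
  have x0 : [set x] !=set0 by exists x.
  have [s [_ [t [[Cs /sgmP[u u01 sE]] -> t01 yE']]]] :=
    conv_hullE cS.2 (cc1 x).2 S0 x0 Ey.
  have [tu tr] : (t * u = 0 /\ (1 - t) - (1 - r) = 0)%R.
    apply: eP; rewrite -[RHS](subrr y) {1}yE' yE sE.
    by apply/rowP => j; rewrite !mxE; ring.
  have u0 : u != 0%R.
    apply: contra_notN nCq => /eqP u0; move: Cs.
    by rewrite sE u0 scale0r subr0 scale1r add0r.
  have t0 : t = 0%R by move/eqP: tu; rewrite mulf_eq0 (negbTE u0) orbF => /eqP.
  by rewrite yE' t0 scale0r subr0 scale1r add0r.
apply: (@fin_setI _ _ x); [by apply: sub_conv_hull; right|exact: sgmr| |].
  by apply: (fin_sub cE _ fS) => y Sy; apply: sub_conv_hull; left.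
by apply: fin_mem => //; exact: sgml.
Qed.

(** The segments from [x] to [y] and from [q] to [y] meet in [y] alone, and both images are finite
    at [b q]. *)
Let fin_independent3 x y q :
  independent3 q x y -> fin [set x] q -> fin [set y] q.
Proof.
move=> ixy fx.
have cxy := @compact_convex_sgm R c x y.
have cqy := @compact_convex_sgm R c q y.
have -> : [set y] = sgm x y `&` sgm q y.
  apply/seteqP; split=> [_ ->|z [/sgmP[t t01 zE] /sgmP[r r01 zE']]].
    by split; exact: sgmr.
  have [t0 _] : (t = 0 /\ (1 - t) - (1 - r) = 0)%R.
    apply: ixy; rewrite -[RHS](subrr z) {1}zE zE'.
    by apply/rowP => j; rewrite !mxE; ring.
  by rewrite zE t0 scale0r subr0 scale1r add0r.
apply: (@fin_setI _ _ y); [exact: sgmr|exact: sgmr| |].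
  by apply: (fin_sub cxy _ fx) => _ ->; exact: sgml.
by apply: fin_mem => //; exact: sgml.
Qed.

(** A [y] on the line through [q] and [x] is reached in two steps, through a point [q + e] off that
    line. *)
Let fin_all x q : x != q -> fin [set x] q -> forall y, fin [set y] q.
Proof.
move=> xq fx y; have [->|yq] := eqVneq y q; first exact: fin_mem (cc1 q) _.
have [|dep] := pselect (independent3 q x y).
  by move/fin_independent3; apply.
have xq0 : (x - q != 0)%R by rewrite subr_eq0.
have yq0 : (y - q != 0)%R by rewrite subr_eq0.
have [e eP] := independent3_exists c_gt1 xq0.
have fe : fin [set (q + e)%R] q.
  apply: fin_independent3 fx => s t E; apply: eP.
  by rewrite -[RHS]E; congr (_ + _ *: _)%R; apply/rowP => j; rewrite !mxE; ring.
apply: fin_independent3 fe => s t.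
rewrite (_ : q + e - q = e)%R; last by rewrite addrC addKr.
move=> E.
have [u [v [uv uv0]]] : exists u v : R,
    (u *: (x - q) + v *: (y - q) = 0 /\ ~ (u = 0 /\ v = 0))%R.
  apply: contra_notP dep => nuv u v uv; apply: contrapT => uv0.
  by apply: nuv; exists u, v.
have v0 : v != 0%R.
  apply: contra_notN uv0 => /eqP v0; split=> //; move: uv.
  rewrite v0 scale0r addr0 => /eqP; rewrite scaler_eq0 (negbTE xq0) orbF.
  by move/eqP.
have [_ vs] : (- (t * u) = 0 /\ v * s = 0)%R.
  have E' : (v *: (s *: e + t *: (y - q)) - t *: (u *: (x - q) + v *: (y - q))
      = 0)%R by rewrite E uv !scaler0 subrr.
  by apply: eP; rewrite -[RHS]E'; apply/rowP => j; rewrite !mxE; ring.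
have s0 : s = 0%R by move/eqP: vs; rewrite mulf_eq0 (negbTE v0) => /eqP.
split=> //; move: E; rewrite s0 scale0r add0r => /eqP.
by rewrite scaler_eq0 (negbTE yq0) orbF => /eqP.
Qed.

Lemma H_finite C q : compact_convex C -> ~ C q -> H C (b q) = +oo.
Proof.
move=> cC nCq; apply: contrapT => /eqP Cq.
have [x xq fx] := fin_neq_mem (conj cC Cq) nCq.
have fq := fin_all xq fx.
(* Finiteness moves from [q] to [y] by convexity of [H [set u]] for the reflection [u] of [q] in
   [y]: it is finite at [b q], zero at [b u], hence finite at the midpoint [b y]. *)
have all_fin y : fin [set 0%R] y.
  have [->|yq] := eqVneq y q; first exact: fq.
  pose u := (2 *: y - q)%R.
  have uy : u != y.
    apply: contra_neq yq => /rowP E; apply/rowP => j; have := E j.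
    by rewrite !mxE; lra.
  apply: (fin_all uy); split; first exact: cc1.
  have [_ cH] := Cvx_0yP (HC0 (cc1 u)).
  have half : (0 <= (2^-1 : R) <= 1)%R by lra.
  have := cH (b q) (b u) 2^-1%R half.
  have -> : (2^-1 *: b q + (1 - 2^-1) *: b u = b y)%R.
    rewrite [b q]bA [b u]bA [b y]bA /u mulmxBl -scalemxAl.
    by apply/rowP => j; rewrite !mxE; field.
  move=> le; rewrite -ltey; apply: (le_lt_trans le).
  by rewrite Hb mule0 adde0 lte_mul_pinfty ?lee_fin ?fin_numE// ltey (fq u).2.
have [H01 [_ kH]] := HC (cc1 0%R).
have [N [_ NP]] := compact_bounded kH.
have NN : (N < `|N| + 1)%R by rewrite (le_lt_trans (ler_norm N))// ltrDl.
(* A vector beyond the bound on the domain of [H [set 0]], yet in the range of [b]. *)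
pose w : V := const_mx (`|N| + 2)%R.
pose y := ((w - b 0) *m invmx A)%R.
have wy : w = b y by rewrite bA /y mulmxKV// subrK.
have : (`|w| <= `|N| + 1)%R.
  apply: NP => //=; rewrite wy; have [_ fy] := all_fin y.
  by case: (H01 (b y)) => // E; rewrite E eqxx in fy.
have := coord_le_norm w (Ordinal (ltnW c_gt1)); rewrite mxE.
have := ler_norm (`|N| + 2)%R.
by lra.
Qed.

End Finite.

Lemma H_indic : exists (b : V -> V) (A : 'M[R]_c),
  [/\ A \in unitmx, forall x, b x = (x *m A + b 0)%R &
      forall C, compact_convex C -> H C = indic_oo (b @` C)].
Proof.
have [b [A [Au bA Hb]]] := H_set1_affine; exists b, A; split=> // C cC.
apply/funext => y; rewrite /indic_oo.
have [q qE] : exists q, y = b q.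
  by exists ((y - b 0) *m invmx A)%R; rewrite bA mulmxKV// subrK.
have b_inj : injective b.
  by move=> u v; rewrite bA [RHS]bA => /addIr/(can_inj (mulmxK Au)).
have [Cq|nCq] := pselect (C q).
  rewrite ifT; last by apply/mem_set; exists q.
  apply/eqP; rewrite eq_le H_ge0// andbT qE.
  apply: (@le_trans _ _ (H [set q] (b q))); last by rewrite Hb.
  by apply: H_sub => //; [exact: cc1|move=> _ ->].
rewrite ifF; first by rewrite qE (H_finite Au bA Hb).
apply/negbTE/negP => /set_mem[u Cu]; rewrite qE => /b_inj uq.
by apply: nCq; rewrite -uq.
Qed.

End Proper.

End Homomorphism.

Theorem theorem7p15 (R : realType) (kappa : R) (c : nat)
    (H : set 'rV[R]_c -> ('rV[R]_c -> \bar R)) :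
  0 < kappa -> (3 <= c)%N ->
  (forall C, compact_convex C -> Cvx_0k kappa (H C)) ->
  (forall C D, compact_convex C -> compact_convex D ->
     H (C `&` D) = cvx_meet (H C) (H D)) ->
  (forall C D, compact_convex C -> compact_convex D ->
     H (conv_hull (C `|` D)) = cvx_join (H C) (H D)) ->
  (exists C D, compact_convex C /\ compact_convex D /\ H C <> H D) ->
  exists phi : 'rV[R]_c -> 'rV[R]_c,
    affine_map phi /\ bijective phi /\
    forall C, compact_convex C -> H C = indic_oo (phi @` C).
Proof.
move=> _ /ltnW c1 HC Hm Hj [C [D [cC [cD CD]]]].
have nH1 : ~ forall p, H [set p] = H set0.
  by move=> H1; apply: CD; rewrite !(H_cst c1 HC Hm Hj H1).
have H0 : H set0 = cst +oo%E.
  have [[k Hk]|//] := H_zero HC (@compact_convex0 R c).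
  by case: nH1; exact: (H_set1_set0 HC Hm Hj Hk).
have [p0 [z0 Hp0]] : exists p z, H [set p] z = 0%E.
  apply: contra_notP nH1 => nz p; rewrite H0.
  have [[z Hz]|//] := H_zero HC (compact_convex1 p).
  by case: nz; exists p, z.
have [b [A [Au bA Hb]]] := H_indic c1 HC Hm Hj H0 Hp0.
exists b; split; first by exists (mulmxr A), (b 0) => x; exact: bA.
split=> //; exists (fun y => (y - b 0) *m invmx A) => x.
  by rewrite bA addrK mulmxK.
by rewrite bA mulmxKV// subrK.
Qed.
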